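(* Let $\mathfrak{A}$ be a $C^*$-algebra and $\mathscr{X}$ a Hilbert $\mathfrak{A}$-module. Then the sequence $\left(\|\cdot\|_n^{*}:n\in\mathbb{N}\right)$ is a multi-norm based on $\mathscr{X}$, i.e. $\left((\mathscr{X}^n,\|\cdot\|_n^{*}):n\in\mathbb{N}\right)$ is a multi-normed space.
   Context: A Hilbert $\mathfrak{A}$-module is a right $\mathfrak{A}$-module with an $\mathfrak{A}$-valued inner product $\langle\cdot,\cdot\rangle$ (linear in the second variable), complete in the norm $\|x\|=\|\langle x,x\rangle\|^{1/2}$; write $|x|=\langle x,x\rangle^{1/2}$ and $\mathscr{X}_{[1]}$ for the closed unit ball of $\mathscr{X}$. For $y_1,\dots,y_n\in\mathscr{X}$ set $$\mu^*_n(y_1,\dots,y_n)=\sup_{z\in\mathscr{X}_{[1]}}\Big\|\Big(\sum_{i=1}^n|\langle y_i,z\rangle|^2\Big)^{1/2}\Big\|,$$ and for $x=(x_1,\dots,x_n)\in\mathscr{X}^n$ set $$\|x\|_n^{*}=\sup\Big\{\Big\|\sum_{i=1}^n|\langle y_i,x_i\rangle|^2\Big\|^{1/2}: y_1,\dots,y_n\in\mathscr{X},\ \mu^*_n(y_1,\dots,y_n)\le 1\Big\}.$$ A multi-norm based on a normed space $\mathcal{X}$ is a sequence $(\|\cdot\|_n:n\in\mathbb{N})$ where $\|\cdot\|_n$ is a norm on $\mathcal{X}^n$, $\|x_0\|_1=\|x_0\|$ for $x_0\in\mathcal{X}$, and for all $n$ and $x=(x_1,\dots,x_n)\in\mathcal{X}^n$: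 (A1) $\|(x_{\sigma(1)},\dots,x_{\sigma(n)})\|_n=\|x\|_n$ for every permutation $\sigma$; (A2) $\|(\alpha_1x_1,\dots,\alpha_nx_n)\|_n\le(\max_i|\alpha_i|)\|x\|_n$ for all $\alpha_i\in\mathbb{C}$; (A3) $\|(x_1,\dots,x_{n-1},0)\|_n=\|(x_1,\dots,x_{n-1})\|_{n-1}$; (A4) $\|(x_1,\dots,x_{n-1},x_{n-1})\|_n\le\|(x_1,\dots,x_{n-1})\|_{n-1}$. *)

(* Defs.v *)
From HB Require Import structures.
From mathcomp Require Import all_boot all_order all_algebra all_fingroup.
From mathcomp Require Import boolp classical_sets reals.
From mathcomp Require Import complex.
From Stdlib Require Import ClassicalEpsilon.
Set Implicit Arguments. Unset Strict Implicit. Unset Printing Implicit Defensive.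
Import Order.TTheory GRing.Theory Num.Theory.
Local Open Scope ring_scope.

Section Defs.
Variable R : realType.
Local Notation C := (R[i]).

Definition cmod (z : C) : R := Num.sqrt (complex.Re z ^+ 2 + complex.Im z ^+ 2).

Definition complete_wrt (V : zmodType) (nrm : V -> R) : Prop :=
  forall u : nat -> V,
    (forall e : R, 0 < e -> exists N : nat, forall m n : nat,
        (N <= m)%N -> (N <= n)%N -> nrm (u m - u n) < e) ->
    exists l : V, forall e : R, 0 < e -> exists N : nat, forall n : nat,
        (N <= n)%N -> nrm (u n - l) < e.

Record is_cstar_algebra (A : lmodType C) (mul : A -> A -> A) (star : A -> A)
    (nrm : A -> R) : Prop := {
  ca_mulA : forall a b c, mul a (mul b c) = mul (mul a b) c;
  ca_mulDl : forall a b c, mul (a + b) c = mul a c + mul b c;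
  ca_mulDr : forall a b c, mul a (b + c) = mul a b + mul a c;
  ca_mulZl : forall (k : C) a b, mul (k *: a) b = k *: mul a b;
  ca_mulZr : forall (k : C) a b, mul a (k *: b) = k *: mul a b;
  ca_starD : forall a b, star (a + b) = star a + star b;
  ca_starZ : forall (k : C) a, star (k *: a) = (conjc k) *: star a;
  ca_starK : forall a, star (star a) = a;
  ca_starM : forall a b, star (mul a b) = mul (star b) (star a);
  ca_nrm_ge0 : forall a, 0 <= nrm a;
  ca_nrm_eq0 : forall a, nrm a = 0 -> a = 0;
  ca_nrmZ : forall (k : C) a, nrm (k *: a) = cmod k * nrm a;
  ca_nrmD : forall a b, nrm (a + b) <= nrm a + nrm b;
  ca_nrmM : forall a b, nrm (mul a b) <= nrm a * nrm b;
  ca_complete : complete_wrt nrm;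
  ca_cstar : forall a, nrm (mul (star a) a) = nrm a ^+ 2
}.

Definition cpos (A : lmodType C) (mul : A -> A -> A) (star : A -> A) (a : A) : Prop :=
  exists b, a = mul (star b) b.

(* the positive square root: a positive b with b b = a (unique when a >= 0) *)
Definition csqrt (A : lmodType C) (mul : A -> A -> A) (star : A -> A) (a : A) : A :=
  epsilon (inhabits (0 : A)) (fun b => cpos mul star b /\ mul b b = a).

Definition cabs (A : lmodType C) (mul : A -> A -> A) (star : A -> A) (a : A) : A :=
  csqrt mul star (mul (star a) a).

Record is_hilbert_module (A : lmodType C) (mul : A -> A -> A) (star : A -> A)
    (nrm : A -> R) (X : lmodType C) (act : X -> A -> X) (ip : X -> X -> A) : Prop := {
  hm_actDl : forall x y a, act (x + y) a = act x a + act y a;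
  hm_actDr : forall x a b, act x (a + b) = act x a + act x b;
  hm_actA : forall x a b, act (act x a) b = act x (mul a b);
  hm_actZl : forall (k : C) x a, act (k *: x) a = k *: act x a;
  hm_actZr : forall (k : C) x a, act x (k *: a) = k *: act x a;
  hm_ipDr : forall x y z, ip x (y + z) = ip x y + ip x z;
  hm_ipZr : forall (k : C) x y, ip x (k *: y) = k *: ip x y;
  hm_ipM : forall x y a, ip x (act y a) = mul (ip x y) a;
  hm_ip_star : forall x y, ip y x = star (ip x y);
  hm_ip_pos : forall x, cpos mul star (ip x x);
  hm_ip_eq0 : forall x, ip x x = 0 -> x = 0;
  hm_complete : complete_wrt (fun x => Num.sqrt (nrm (ip x x)))
}.

Section Module.
Variables (A : lmodType C) (mul : A -> A -> A) (star : A -> A) (nrm : A -> R).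
Variables (X : lmodType C) (act : X -> A -> X) (ip : X -> X -> A).

Definition hnorm (x : X) : R := Num.sqrt (nrm (ip x x)).

Local Notation sq a := (mul (cabs mul star a) (cabs mul star a)).

Definition mu_star (n : nat) (y : 'I_n -> X) : R :=
  sup [set r : R | exists z : X, hnorm z <= 1 /\
        r = nrm (csqrt mul star (\sum_(i < n) sq (ip (y i) z)))].

Definition mnorm_star (n : nat) (x : 'I_n -> X) : R :=
  sup [set r : R | exists y : 'I_n -> X, mu_star y <= 1 /\
        r = Num.sqrt (nrm (\sum_(i < n) sq (ip (y i) (x i))))].
End Module.

Definition is_norm_n (X : lmodType C) (n : nat) (N : ('I_n -> X) -> R) : Prop :=
  [/\ forall x, 0 <= N x,
      forall x, N x = 0 -> forall i, x i = 0,
      forall (k : C) x, N (fun i => k *: x i) = cmod k * N x &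
      forall x y, N (fun i => x i + y i) <= N x + N y].

Record is_multinorm (X : lmodType C) (nX : X -> R)
    (N : forall n : nat, ('I_n -> X) -> R) : Prop := {
  mn_norm : forall n, (0 < n)%N -> is_norm_n (N n);
  mn_one : forall x0 : X, N 1%N (fun _ => x0) = nX x0;
  mn_A1 : forall n (x : 'I_n -> X) (s : 'S_n), (0 < n)%N ->
    N n (fun i => x (s i)) = N n x;
  mn_A2 : forall n (x : 'I_n -> X) (al : 'I_n -> C), (0 < n)%N ->
    N n (fun i => al i *: x i) <= (\big[Num.max/0]_(i < n) cmod (al i)) * N n x;
  (* (A3), for n = m.+2: (x_1,...,x_{n-1},0) *)
  mn_A3 : forall m (x : 'I_m.+1 -> X),
    N m.+2 (fun i => if unlift ord_max i is Some j then x j else 0) = N m.+1 x;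
  (* (A4), for n = m.+2: (x_1,...,x_{n-1},x_{n-1}) *)
  mn_A4 : forall m (x : 'I_m.+1 -> X),
    N m.+2 (fun i => if unlift ord_max i is Some j then x j else x ord_max)
      <= N m.+1 x
}.
End Defs.

(* Main.v *)
(** The triangle inequality and (A1)-(A3) follow from the Cauchy-Schwarz inequality in
    the Hilbert modules [X] and [A^n] and from monotonicity of the norm on positive
    elements. For (A4), a contractive family [(.., y_{n-1}, y_n)] is replaced by
    [(.., y_{n-1} a + y_n b)], where [(a, b)] approximates the polar part of the column
    [(<y_{n-1}, x_{n-1}>, <y_n, x_{n-1}>)]; since [(a, b)] is a contraction, the new family
    is again contractive, and the sum of squares changes by an arbitrarily small amount.

    Positivity is handled without spectra, in the unitization: a self-adjoint [h] is
    positive when [|t - h| <= t] for some [t > 0]. Positive elements have square roots,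
    given by a monotone iteration, and [a^* a] is positive because no nonzero [x] has
    [- x^* x] positive. *)

Require Import Defs.
From HB Require Import structures.
From mathcomp Require Import all_boot all_order all_algebra all_fingroup.
From mathcomp Require Import boolp classical_sets reals complex.
From mathcomp Require Import ring lra.
From Stdlib Require Import ClassicalEpsilon.
Set Implicit Arguments. Unset Strict Implicit. Unset Printing Implicit Defensive.
Import Order.TTheory GRing.Theory Num.Theory.
Local Open Scope ring_scope.
Local Open Scope complex_scope.

(** * Positivity in a unital C-star algebra *)

(** The step for (A4) cannot be exact: the polar part of a column exists in a von Neumann algebra,
    but a C-star algebra need not contain it. This is why [(h + e)^(-1/2)] replaces [h^(-1/2)] and
    why the bound carries an arbitrary [e > 0]. The definitions pick square roots and absolute
    values by [epsilon], so nothing can be said about them until every sum of elements [b^* b] is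
    known to have a positive root. The form [b^* b] is not visibly stable under sums; the norm
    condition is, but does not visibly hold for [b^* b]. Reconciling the two is the main obstacle.
    The commutation clauses attached to roots and inverses stand in for functional calculus: they
    make everything built from one self-adjoint element commute. The norm condition needs a unit,
    which [A] may lack. In the unitization [A] is an ideal, the kernel of a character, so roots of
    elements of [A] and their products with outside elements fall back into [A]. *)

Section Cmod.
Variable R : realType.

Lemma cmod_norm (z : R[i]) : (cmod z)%:C = `|z|.
Proof. by rewrite normc_def. Qed.

Lemma cmod_ge0 (z : R[i]) : 0 <= cmod z.
Proof. exact: sqrtr_ge0. Qed.

Lemma cmodM (x y : R[i]) : cmod (x * y) = cmod x * cmod y.
Proof. by apply: (@complexI R); rewrite rmorphM /= !cmod_norm normrM. Qed.

Lemma cmodD (x y : R[i]) : cmod (x + y) <= cmod x + cmod y.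
Proof. by rewrite -lecR rmorphD /= !cmod_norm ler_normD. Qed.

Lemma cmod_real (r : R) : cmod r%:C = `|r|.
Proof. by rewrite /cmod /= expr0n addr0 sqrtr_sqr. Qed.

Lemma cmod1 : cmod (1 : R[i]) = 1.
Proof. by apply: (@complexI R); rewrite cmod_norm normr1. Qed.

Lemma cmodN1 : cmod (-1 : R[i]) = 1.
Proof. by apply: (@complexI R); rewrite cmod_norm normrN1. Qed.

Lemma cmod0 : cmod (0 : R[i]) = 0.
Proof. by apply: (@complexI R); rewrite cmod_norm normr0. Qed.

Lemma cmod_eq0 (z : R[i]) : cmod z = 0 -> z = 0.
Proof. by move=> z0; apply/normr0_eq0; rewrite -cmod_norm z0. Qed.

Lemma cmod_conj (z : R[i]) : cmod (conjc z) = cmod z.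
Proof. by case: z => a b; rewrite /cmod /= sqrrN. Qed.

End Cmod.

Section UnitalCstar.
Variables (R : realType) (B : algType R[i]) (st : B -> B) (nm : B -> R).

Definition sc (r : R) : B := (in_alg B \o real_complex R) r.
HB.instance Definition _ := GRing.RMorphism.copy sc (in_alg B \o real_complex R).

Lemma sc_mulE r x : sc r * x = r%:C *: x.
Proof. by rewrite /sc /= -scalerAl mul1r. Qed.

Lemma sc_comm r x : x * sc r = sc r * x.
Proof. by rewrite sc_mulE /sc /= -scalerAr mulr1. Qed.

Lemma half_double x : sc 2^-1 * (x + x) = x.
Proof.
rewrite mulrDr -mulrDl -rmorphD /= -[RHS]mul1r -(rmorph1 sc).
by congr (sc _ * _); lra.
Qed.

(* A norm condition equivalent to the spectrum of [h] being in [0, 2t]. *)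
Definition pos (h : B) : Prop :=
  st h = h /\ exists2 t : R, 0 < t & nm (sc t - h) <= t.

Hypothesis HB : is_cstar_algebra (A := B) *%R st nm.

Let nmD := ca_nrmD HB.
Let nmM := ca_nrmM HB.
Let nm_ge0 := ca_nrm_ge0 HB.
Let nm_eq0 := ca_nrm_eq0 HB.
Let nm_cstar := ca_cstar HB.
Let stD := ca_starD HB.
Let stK := ca_starK HB.
Let stM := ca_starM HB.
Let stZ := ca_starZ HB.
Let nmZ := ca_nrmZ HB.

(** * Elementary rules for the involution and the norm *)

Lemma st0 : st 0 = 0.
Proof. by apply: (addrI (st 0)); rewrite -stD !addr0. Qed.

Lemma stN x : st (- x) = - st x.
Proof. by apply/eqP; rewrite -addr_eq0 -stD addNr st0. Qed.

Lemma stB x y : st (x - y) = st x - st y.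
Proof. by rewrite stD stN. Qed.

Lemma st1 : st 1 = 1.
Proof. by have := stM (st 1) 1; rewrite mulr1 !stK mulr1 => <-. Qed.

Lemma st_sc r : st (sc r) = sc r.
Proof. by rewrite /sc /= stZ st1 conjc_real. Qed.

Lemma nm0 : nm 0 = 0.
Proof. by rewrite -(scale0r (0 : B)) nmZ cmod0 mul0r. Qed.

Lemma nmN x : nm (- x) = nm x.
Proof. by rewrite -scaleN1r nmZ cmodN1 mul1r. Qed.

Lemma nmB x y : nm (x - y) = nm (y - x).
Proof. by rewrite -nmN opprB. Qed.

(** The C-star identity makes [nm 1] idempotent, and it is nonzero because [1 != 0] in [B]. *)
Lemma nm1 : nm 1 = 1.
Proof.
have := nm_cstar 1; rewrite mulr1 st1 => /eqP.
rewrite expr2 -subr_eq0 -{1}(mulr1 (nm 1)) -mulrBr mulf_eq0 => /orP [/eqP /nm_eq0 /eqP|].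
  by rewrite oner_eq0.
by rewrite subr_eq0 => /eqP.
Qed.

Lemma nm_sc r : nm (sc r) = `|r|.
Proof. by rewrite /sc /= nmZ nm1 mulr1 cmod_real. Qed.

Lemma nm_scM r x : nm (sc r * x) = `|r| * nm x.
Proof. by rewrite sc_mulE nmZ cmod_real. Qed.

Lemma nm_st x : nm (st x) = nm x.
Proof.
have le y : nm y <= nm (st y).
  have := nm_ge0 y; rewrite le_eqVlt => /orP [/eqP <- //|y0].
  by rewrite -(ler_pM2r y0) -expr2 -nm_cstar nmM.
by apply/eqP; rewrite eq_le le andbT -{2}(stK x) le.
Qed.

Lemma nm_sa_sqr h : st h = h -> nm (h * h) = nm h ^+ 2.
Proof. by move=> hs; rewrite -nm_cstar hs. Qed.

(** * Limits in norm and the square root iteration *)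

Definition tends (u : nat -> B) (l : B) : Prop :=
  forall e : R, 0 < e -> exists N : nat, forall n : nat, (N <= n)%N -> nm (u n - l) < e.

(** The real sequence [s] is nondecreasing and bounded, and its increments dominate those of [y], so
    [y] is Cauchy. Serves both the square root iteration and the Neumann series. *)
Lemma tends_majorant (y : nat -> B) (s : nat -> R) (M : R) :
  (forall n, nm (y n.+1 - y n) <= s n.+1 - s n) -> (forall n, s n <= M) ->
  exists l, tends y l.
Proof.
move=> ys sM.
have dist n k : nm (y (n + k)%N - y n) <= s (n + k)%N - s n.
  elim: k => [|k IH]; first by rewrite addn0 !subrr nm0.
  have := nmD (y (n + k).+1 - y (n + k)%N) (y (n + k)%N - y n).
  rewrite addrA subrK addnS => /le_trans; apply.
  by have := ys (n + k)%N; lra.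
apply: (ca_complete HB) => e e0.
pose S := [set s n | n in [set: nat]]%classic.
have hS : has_sup S by split; [exists (s 0%N), 0%N|exists M => _ [n _ <-]].
have e40 : 0 < e / 2 by lra.
have [_ [N _ <-] sN] := sup_adherent e40 hS.
have ub n : s n <= sup S by apply: ub_le_sup; [case: hS|exists n].
have near n : (N <= n)%N -> nm (y n - y N) < e / 2.
  by move=> /subnKC <-; have := dist N (n - N)%N; have := ub (N + (n - N))%N; lra.
exists N => m n /near mN /near nN.
have := nmD (y m - y N) (y N - y n); rewrite addrA subrK (nmB (y N)).
by lra.
Qed.

Lemma nm_small_eq0 x K : (forall e, 0 < e -> nm x <= K * e) -> x = 0.
Proof.
move=> small; apply: nm_eq0; apply/eqP; rewrite eq_le nm_ge0 andbT leNgt.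
apply/negP => x0.
have e0 : 0 < nm x / (2 * (`|K| + 1)) by rewrite divr_gt0 // mulr_gt0 // ltr_wpDl.
have /= := small _ e0; rewrite leNgt => /negP; apply.
have K1 : 0 < `|K| + 1 by rewrite ltr_wpDl.
rewrite mulrA ltr_pdivrMr ?mulr_gt0 // mulrC ltr_pM2l //.
by have := ler_norm K; have := normr_ge0 K; lra.
Qed.

(** The kernel of a bounded additive map is closed; commutation and self-adjointness pass to limits
    this way. *)
Lemma tends_additive_eq0 (F : B -> B) K u l :
  (forall a b, F (a - b) = F a - F b) -> (forall a, nm (F a) <= K * nm a) ->
  tends u l -> (forall n, F (u n) = 0) -> F l = 0.
Proof.
move=> FB FK ul Fu; apply: (@nm_small_eq0 _ `|K|) => e e0.
have [N /(_ N (leqnn N)) uN] := ul e e0.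
rewrite -nmN -(sub0r (F l)) -(Fu N) -FB (le_trans (FK _)) //.
apply: (le_trans (ler_wpM2r (nm_ge0 _) (ler_norm K))).
by rewrite ler_wpM2l // ltW.
Qed.

Lemma tends_nm_le u l K : tends u l -> (forall n, nm (u n) <= K) -> nm l <= K.
Proof.
move=> ul uK; rewrite leNgt; apply/negP => lK.
have [|N /(_ N (leqnn N)) uN] := ul (nm l - K); first lra.
have := nmD (l - u N) (u N); rewrite subrK nmB.
by have := uK N; lra.
Qed.

Lemma tends_comm u l z : tends u l -> (forall n, z * u n = u n * z) -> z * l = l * z.
Proof.
move=> ul zu; apply/eqP; rewrite -subr_eq0; apply/eqP.
apply: (@tends_additive_eq0 (fun a => z * a - a * z) (nm z + nm z) _ _ _ _ ul).
- by move=> a b; rewrite mulrBr mulrBl !opprB addrACA [RHS]addrACA [- (a * z) - _]addrC.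
- move=> a; apply: (le_trans (nmD _ _)); rewrite nmN mulrDl lerD ?nmM //.
  by rewrite mulrC nmM.
- by move=> n; rewrite zu subrr.
Qed.

Lemma tends_sa u l : tends u l -> (forall n, st (u n) = u n) -> st l = l.
Proof.
move=> ul su; apply/eqP; rewrite -subr_eq0; apply/eqP.
apply: (@tends_additive_eq0 (fun a => st a - a) 2 _ _ _ _ ul).
- by move=> a b; rewrite stB !opprB addrACA [RHS]addrACA [- st b - _]addrC.
- by move=> a; rewrite (le_trans (nmD _ _)) // nmN nm_st; lra.
- by move=> n; rewrite su subrr.
Qed.


(* The iteration [y <- (x + y^2)/2] converges to [1 - sqrt (1 - x)]; the same
   iteration at the scalar [1] majorizes it. *)
Lemma sqrt_one_sub x : nm x <= 1 -> st x = x ->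
  exists y, [/\ st y = y, nm y <= 1, (1 - y) * (1 - y) = 1 - x &
    forall z, z * x = x * z -> z * y = y * z].
Proof.
move=> x1 xs.
pose y := fix y n := if n is m.+1 then sc 2^-1 * (x + y m * y m) else 0.
pose s := fix s n : R := if n is m.+1 then 2^-1 * (1 + s m * s m) else 0.
have yS n : y n.+1 = sc 2^-1 * (x + y n * y n) by [].
have sS n : s n.+1 = 2^-1 * (1 + s n * s n) by [].
have yC n z : z * x = x * z -> z * y n = y n * z.
  move=> zx; elim: n => [|n IH]; first by rewrite mulr0 mul0r.
  rewrite yS mulrA sc_comm -!mulrA; congr (_ * _).
  by rewrite mulrDr mulrDl zx mulrA IH -!mulrA IH.
have ysa n : st (y n) = y n.
  elim: n => [|n IH]; first exact: st0.
  by rewrite yS stM stD stM !IH xs st_sc sc_comm.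
have s01 n : 0 <= s n <= 1.
  by elim: n => [|n /andP [a b]]; rewrite ?sS /= ?lexx ?ler01 //; apply/andP; nra.
have ys n : nm (y n) <= s n.
  elim: n => [|n IH]; first by rewrite nm0.
  rewrite yS sS nm_scM ger0_norm ?invr_ge0 // ler_pM2l ?invr_gt0 //.
  by rewrite (le_trans (nmD _ _)) // lerD // (le_trans (nmM _ _)) // ler_pM.
have dy n : nm (y n.+1 - y n) <= s n.+1 - s n.
  elim: n => [|n IH].
    rewrite /= mulr0 addr0 !subr0 nm_scM ger0_norm ?invr_ge0 //.
    by rewrite mulr0 addr0 ler_pM2l ?invr_gt0.
  (* Iterates commute, so a difference of their squares factors and its norm is controlled by the
     scalar iteration. *)
  have cy : y n.+1 * y n = y n * y n.+1 by apply: (yC); apply/esym/(yC).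
  have diff a b : a * b = b * a ->
      sc 2^-1 * (x + a * a) - sc 2^-1 * (x + b * b) = sc 2^-1 * ((a - b) * (a + b)).
    move=> ab; rewrite -mulrBr; congr (_ * _).
    rewrite mulrBl !mulrDr ab !opprD !addrA addrK; congr (_ - _).
    by rewrite [x + _]addrC addrK.
  rewrite (yS n.+1) [X in _ - X](yS n) diff //.
  rewrite nm_scM ger0_norm ?invr_ge0 //.
  have -> : s n.+2 - s n.+1 = 2^-1 * ((s n.+1 - s n) * (s n.+1 + s n)).
    by rewrite (sS n.+1) [X in _ - X = _](sS n); ring.
  rewrite ler_pM2l ?invr_gt0 // (le_trans (nmM _ _)) // ler_pM //.
  by rewrite (le_trans (nmD _ _)) // lerD.
have [|l yl] := tends_majorant dy (M := 1); first by move=> n; case/andP: (s01 n).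
have l1 : nm l <= 1.
  by apply: tends_nm_le yl _ => n; rewrite (le_trans (ys n)) //; case/andP: (s01 n).
have lfix : l = sc 2^-1 * (x + l * l).
  apply/eqP; rewrite -subr_eq0; apply/eqP; apply: (@nm_small_eq0 _ 2) => e e0.
  have [N yN] := yl e e0.
  (* The difference of squares is split without commuting [y N] and [l]; each factor left beside
     [y N - l] has norm at most one. *)
  have -> : l - sc 2^-1 * (x + l * l) = (l - y N.+1) +
      sc 2^-1 * (y N * (y N - l) + (y N - l) * l).
    rewrite yS mulrBr mulrBl addrA subrK -[RHS]addrA; congr (_ + _).
    by rewrite -!(mulrN (sc _)) -mulrDr !opprD addrA subrK.
  have a1 := yN _ (leqnSn N); have a2 := yN _ (leqnn N).
  rewrite (le_trans (nmD _ _)) // nmB nm_scM ger0_norm ?invr_ge0 //.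
  have b : nm (y N * (y N - l) + (y N - l) * l) <= e + e.
    rewrite (le_trans (nmD _ _)) // lerD // (le_trans (nmM _ _)) //.
      rewrite -[e]mul1r; apply: ler_pM => //; last exact: ltW.
      by rewrite (le_trans (ys N)) //; case/andP: (s01 N).
    by rewrite -[e]mulr1; apply: ler_pM => //; exact: ltW.
  by move: a1 b; set u := nm _; set v := nm _; move=> *; lra.
exists l; split=> //.
- exact: tends_sa yl ysa.
- have : l + l = x + l * l.
    rewrite {1 2}lfix -mulrDl -rmorphD /= -[RHS]mul1r; congr (_ * _).
    by rewrite -(rmorph1 sc); congr sc; lra.
  move=> ll; have -> : x = l + l - l * l by rewrite ll addrK.
  rewrite mulrBr mulr1 mulrBl mul1r !opprB -[LHS]addrA; congr (_ + _).
  by rewrite addrCA -opprD.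
- by move=> z zx; apply: tends_comm yl _ => n; apply: yC.
Qed.


(** * The cone of positive elements and its square roots *)

Lemma pos_sa p : pos p -> st p = p. Proof. by case. Qed.

Lemma pos_mulsc r h : 0 < r -> pos h -> pos (sc r * h).
Proof.
move=> r0 [hs [t t0 ht]]; split; first by rewrite stM hs st_sc sc_comm.
exists (r * t); first exact: mulr_gt0.
by rewrite rmorphM /= -mulrBr nm_scM gtr0_norm // ler_pM2l.
Qed.

Lemma pos0 : pos 0.
Proof. by split; [exact: st0|exists 1; rewrite ?subr0 ?nm_sc ?normr1]. Qed.

(** With the norm form of positivity this is the triangle inequality, the witnesses adding up. *)
Lemma posD p q : pos p -> pos q -> pos (p + q).
Proof.
move=> [ps [t t0 pt]] [qs [u u0 qu]]; split; first by rewrite stD ps qs.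
exists (t + u); first exact: addr_gt0.
rewrite rmorphD /= opprD addrACA; apply: (le_trans (nmD _ _)); exact: lerD.
Qed.

(** If [t] witnesses positivity, [p / t = 1 - x] with [nm x <= 1], and [sqrt t * (1 - y)] is the
    root. It is positive with witness [1] before scaling, since [nm y <= 1]. *)
Lemma pos_sqrt p : pos p ->
  exists k, [/\ pos k, k * k = p & forall z, z * p = p * z -> z * k = k * z].
Proof.
move=> [ps [t t0 pt]]; have tn : t != 0 by rewrite gt_eqF.
have [||y [ys y1 yy yc]] := @sqrt_one_sub (1 - sc t^-1 * p).
- have -> : 1 - sc t^-1 * p = sc t^-1 * (sc t - p).
    by rewrite mulrBr -rmorphM /= mulVf ?gt_eqF // rmorph1.
  by rewrite nm_scM gtr0_norm ?invr_gt0 // -(mulVf tn) ler_pM2l ?invr_gt0.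
- by rewrite stB st1 stM ps st_sc sc_comm.
have rt0 : 0 < Num.sqrt t by rewrite sqrtr_gt0.
exists (sc (Num.sqrt t) * (1 - y)); split.
- apply: pos_mulsc => //; split; first by rewrite stB st1 ys.
  by exists 1; rewrite // rmorph1 opprB addrC subrK.
- rewrite mulrA -(mulrA (sc _) (1 - y)) sc_comm mulrA -rmorphM /= -mulrA yy.
  rewrite -expr2 sqr_sqrtr ?ltW // opprB addrC subrK mulrA -rmorphM /= divff ?gt_eqF //.
  by rewrite rmorph1 mul1r.
- move=> z zp; rewrite mulrA sc_comm -!mulrA; congr (_ * _).
  rewrite mulrBr mulrBl mulr1 mul1r yc // mulrBr mulrBl mulr1 mul1r.
  by rewrite mulrA sc_comm -!mulrA zp.
Qed.

(** * Commuting squares, order and norm, positivity of [a^* a] *)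

Definition im : B := in_alg B 'i.

Lemma im_comm x : x * im = im * x.
Proof. by rewrite /im /= -scalerAr -scalerAl mulr1 mul1r. Qed.

Lemma im_im : im * im = -1.
Proof. by rewrite -rmorphM /= -expr2 sqr_i scaleN1r. Qed.

Lemma st_im : st im = - im.
Proof.
rewrite /im /= stZ st1 -scaleNr; congr (_ *: _).
by apply/eqP; rewrite eq_complex /= oppr0 !eqxx.
Qed.

(* [k] is the real part of [u = k + i l], and [st u * u = sc d]. *)
Lemma nm_le_sumsq k l d : st k = k -> st l = l -> k * l = l * k ->
  k * k + l * l = sc d -> nm (k * k) <= `|d|.
Proof.
move=> ks ls kl kld.
pose u := k + im * l.
have su : st u = k - im * l by rewrite stD ks stM ls st_im mulrN -im_comm.
have nu : nm u ^+ 2 = `|d|.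
  rewrite -nm_cstar su mulrBl !mulrDr -nm_sc -kld; congr nm.
  have -> : im * l * (im * l) = - (l * l).
    by rewrite mulrA im_comm !mulrA im_im mulN1r mulNr.
  by rewrite mulrA im_comm -!mulrA kl opprD opprK addrA addrK.
have ku : k = sc 2^-1 * (u + st u).
  have -> : u + st u = k + k by rewrite su addrACA subrr addr0.
  by rewrite half_double.
have kle : nm k <= nm u.
  rewrite ku nm_scM ger0_norm ?invr_ge0 // ler_pdivrMl //.
  by rewrite (le_trans (nmD _ _)) // nm_st; lra.
by rewrite nm_sa_sqr // -nu ler_pXn2r ?nnegrE.
Qed.

(** The root [1 - y] of [1 - h^2] commutes with [h] and the two squares add up to [1], which is the
    situation of [nm_le_sumsq]. *)
Lemma nm_sub_sq h : st h = h -> nm h <= 1 -> nm (1 - h * h) <= 1.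
Proof.
move=> hs h1.
have [||y [ys y1 yy yc]] := @sqrt_one_sub (h * h).
- by rewrite (le_trans (nmM _ _)) // mulr_ile1.
- by rewrite stM hs.
rewrite -yy -(normr1 R); apply: (@nm_le_sumsq _ h) => //.
- by rewrite stB st1 ys.
- by rewrite mulrBl mulrBr mul1r mulr1 yc // mulrA.
- by rewrite yy subrK rmorph1.
Qed.

Lemma pos_sqr h : st h = h -> pos (h * h).
Proof.
(* The summand [1] keeps [r] positive when [h] is zero. *)
move=> hs; pose r := nm h + 1; have r0 : 0 < r by rewrite ltr_wpDl.
pose g := sc r^-1 * h.
have hg : h * h = sc (r ^+ 2) * (g * g).
  have hE : h = sc r * g by rewrite /g mulrA -rmorphM /= divff ?gt_eqF // rmorph1 mul1r.
  by rewrite [in LHS]hE mulrA sc_comm !mulrA -rmorphM -expr2 -mulrA.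
have gs : st g = g by rewrite /g stM hs st_sc sc_comm.
rewrite hg; apply: pos_mulsc; first by rewrite exprn_gt0.
split; first by rewrite stM gs.
exists 1; rewrite // rmorph1; apply: nm_sub_sq => //.
by rewrite /g nm_scM gtr0_norm ?invr_gt0 // ler_pdivrMl // mulr1 /r lerDl.
Qed.

Lemma pos_sc r : 0 <= r -> pos (sc r).
Proof.
rewrite le_eqVlt => /orP [/eqP <-|r0]; first by rewrite rmorph0; exact: pos0.
by split; [exact: st_sc|exists r; rewrite ?subrr ?nm0 // ltW].
Qed.

Lemma pos_scM r p : 0 <= r -> pos p -> pos (sc r * p).
Proof.
rewrite le_eqVlt => /orP [/eqP <-|r0]; last exact: pos_mulsc.
by rewrite rmorph0 mul0r => _; exact: pos0.
Qed.

Lemma pos_sc_sub p d : st p = p -> nm p <= d -> pos (sc d - p).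
Proof.
move=> ps pd; have d0 : 0 <= d by apply: le_trans pd.
split; first by rewrite stB ps st_sc.
(* The witness must be positive even for [d = 0]; here [(d + 1) - (d - p) = 1 + p]. *)
exists (d + 1); first by rewrite ltr_wpDl.
rewrite rmorphD /= opprB addrCA addrAC subrr add0r.
apply: (le_trans (nmD _ _)); rewrite nm_sc normr1; lra.
Qed.

(** The roots of [r] and [d - r] commute and their squares add up to [d]. *)
Lemma pos_le_norm r d : pos r -> pos (sc d - r) -> nm r <= `|d|.
Proof.
move=> pr pd; have [k [pk kk kc]] := pos_sqrt pr; have [l [pl ll lc]] := pos_sqrt pd.
rewrite -kk; apply: (@nm_le_sumsq _ l); rewrite ?pos_sa //; last first.
  by rewrite kk ll addrC subrK.
apply: lc; rewrite mulrBr mulrBl sc_comm; congr (_ - _).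
by rewrite -kk mulrA.
Qed.

Lemma pos_le r d : pos r -> pos (sc d - r) -> nm r <= d.
Proof.
move=> pr pd; have [d0|d0] := leP 0 d; first by rewrite -[d]ger0_norm // pos_le_norm.
(* For [d < 0], adding [- d] to [d - r] makes [- r] positive, hence [r = 0]; then [d] itself would
   be a positive element, which its sign forbids. *)
have pN : pos (sc (- d)) by apply: pos_sc; rewrite oppr_ge0 ltW.
have r0 : r = 0.
  apply: nm_eq0; apply/eqP; rewrite eq_le nm_ge0 andbT -(normr0 R).
  apply: pos_le_norm => //; rewrite -(subrr d) rmorphD /= addrAC; exact: posD.
have [_ [t t0]] := pd; rewrite r0 subr0 -rmorphB nm_sc ger0_norm; lra.
Qed.

Lemma nm_mono p q : pos p -> pos (q - p) -> nm p <= nm q.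
Proof.
move=> pp pqp; have qs : st q = q by rewrite -(subrK p q) stD !pos_sa.
apply: pos_le => //.
rewrite -(subrK q (sc _)) -addrA; apply: posD => //; exact: pos_sc_sub.
Qed.

(** From [t + p <= c] follows [p <= c - t]. The sign of [c - t] is unknown at this point, hence
    [pos_le] rather than [pos_le_norm]. *)
Lemma nm_sc_add p t : pos p -> t + nm p <= nm (sc t + p).
Proof.
move=> pp; set c := nm (sc t + p).
suff : nm p <= c - t by lra.
apply: pos_le => //; rewrite rmorphB /= -addrA -opprD; apply: pos_sc_sub => //.
by rewrite stD st_sc pos_sa.
Qed.

(* With [y = st x] and [d = nm x ^+ 2], compare the norms of [(d + x y)^2] and of
   [d^2 + x (2 d + y x) y]: if [y x] is negative, they are at least [4 d^2] and at
   most [3 d^2] respectively. *)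
Lemma star_mul_neg_eq0 x p : pos p -> st x * x = - p -> x = 0.
Proof.
move=> pp xp; set y := st x in xp.
(* With [x = (a - i b) / 2] for self-adjoint [a] and [b], the sum [x y + y x] is [(a^2 + b^2) / 2];
   removing the negative term [y x = - p] leaves a positive element. *)
have pr : pos (x * y).
  have xy : x * y = (x * y + y * x) + p by rewrite xp subrK.
  rewrite xy; apply: posD => //.
  pose a := x + y; pose b := im * (x - y).
  have as_ : st a = a by rewrite stD stK addrC.
  have bs : st b = b by rewrite stM stB stK st_im mulrN im_comm -mulrN opprB.
  suff -> : x * y + y * x = sc 2^-1 * (a * a + b * b).
    by apply: pos_scM; rewrite ?invr_ge0 //; apply: posD; exact: pos_sqr.
  rewrite -[LHS]half_double; congr (_ * _).
  have -> : b * b = - ((x - y) * (x - y)).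
    by rewrite mulrA im_comm !mulrA im_im mulN1r mulNr.
  rewrite /a !mulrDr !mulrDl !mulrN !mulNr !opprD !opprK.
  rewrite [RHS]addrACA [X in _ = X + _]addrACA [X in _ = _ + X]addrACA !subrr add0r addr0.
  by rewrite [LHS]addrACA addrC.
pose d := nm x ^+ 2.
have d0 : 0 <= d by rewrite exprn_ge0.
have nr : nm (x * y) = d by rewrite -{1}(stK x) nm_cstar nm_st.
have np : nm p = d by rewrite -nmN -xp nm_cstar.
have ps := pos_sa pp.
have n1 : nm (sc d + y * x) <= d.
  rewrite xp; apply: pos_le; first by apply: pos_sc_sub; rewrite ?np.
  by rewrite opprB addrC subrK.
have e : (sc d + x * y) * (sc d + x * y) =
    sc d * sc d + x * ((sc d + (sc d + y * x)) * y).
  rewrite mulrDl !mulrDr -addrA; congr (_ + _).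
  rewrite !mulrDl !mulrDr !mulrA (sc_comm d (x * y)) !(sc_comm d x) !mulrA.
  by rewrite !addrA.
have l1 : (d + d) ^+ 2 <= nm ((sc d + x * y) * (sc d + x * y)).
  rewrite nm_sa_sqr ?ler_pXn2r ?nnegrE ?addr_ge0 //; last first.
    by rewrite stD st_sc pos_sa.
  by rewrite -{2}nr; exact: nm_sc_add.
have u1 : nm ((sc d + x * y) * (sc d + x * y)) <= d * d + d * (d + d).
  rewrite e (le_trans (nmD _ _)) // lerD //.
    by rewrite -rmorphM nm_sc ger0_norm ?mulr_ge0.
  apply: (le_trans (nmM _ _)).
  have -> : d * (d + d) = nm x * ((d + d) * nm x) by rewrite /d; ring.
  apply: ler_wpM2l => //; apply: (le_trans (nmM _ _)); rewrite nm_st.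
  apply: ler_wpM2r => //; apply: (le_trans (nmD _ _)); apply: lerD => //.
  by rewrite nm_sc ger0_norm.
have dd : d ^+ 2 = 0.
  apply/eqP; rewrite eq_le sqr_ge0 andbT; move: (le_trans l1 u1).
  by rewrite -subr_ge0 => H; nra.
apply: nm_eq0; apply/eqP; move/eqP: dd; by rewrite /d !expf_eq0.
Qed.

(* With [k = |h|] and [c = k - h], the element [st (a c) (a c) = c h c = - k c^2] is
   negative, hence [a c = 0] and [h = k]. *)
Lemma pos_star_mul a : pos (st a * a).
Proof.
set h := st a * a.
have hs : st h = h by rewrite stM stK.
have [k [pk kk kc]] := pos_sqrt (pos_sqr hs).
have kh : h * k = k * h by apply: kc; rewrite mulrA.
have [m [pm mm mc]] := pos_sqrt pk.
have ks := pos_sa pk; have ms := pos_sa pm.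
pose c := k - h.
have cs : st c = c by rewrite stB ks hs.
have ck : c * k = k * c by rewrite mulrBl mulrBr kh.
have cm := mc _ ck.
have hc : h * c = - (k * c).
  by rewrite !mulrBr kh kk opprB.
have ac : a * c = 0.
  apply: (@star_mul_neg_eq0 _ ((m * c) * (m * c))).
    by apply: pos_sqr; rewrite stM cs ms cm.
  rewrite stM cs -[LHS]mulrA (mulrA (st a)) -/h hc mulrN; congr (- _).
  by rewrite [LHS]mulrA ck -mm -!mulrA (mulrA c m) cm -!mulrA.
have c0 : c = 0.
  have hc0 : h * c = 0 by rewrite /h -mulrA ac mulr0.
  have kc0 : k * c = 0 by rewrite -[LHS]opprK -hc hc0 oppr0.
  have cc0 : c * c = 0 by rewrite {1}/c mulrBl hc0 kc0 subr0.
  apply: nm_eq0; apply/eqP; have /eqP := nm_sa_sqr cs.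
  by rewrite cc0 nm0 eq_sym expf_eq0.
by rewrite -(subKr k h) -/c c0 subr0.
Qed.

Lemma pos_conj e c : pos e -> pos (st c * e * c).
Proof.
move=> pe; have [k [pk <- _]] := pos_sqrt pe.
rewrite mulrA -[_ * c]mulrA -{1}(pos_sa pk) -stM; exact: pos_star_mul.
Qed.

(** For [E = <e,e>], [F = <f,f>], [G = <e,f>], the last hypothesis is the expansion of
    [<f - e G, f - e G>]. Adding the positive element [G^* (1 - E) G] removes [E], with no inverse
    taken. *)
Lemma pos_cauchy_schwarz E F G : pos E -> nm E <= 1 ->
  pos (F - st G * G - st G * G + st G * E * G) -> pos (F - st G * G).
Proof.
move=> pE E1 /posD /(_ (pos_conj G (pos_sc_sub (pos_sa pE) E1))).
rewrite rmorph1 mulrBr mulr1 mulrBl -addrA [st G * E * G + _]addrC.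
by rewrite subrK subrK.
Qed.

(** * Neumann series and approximate inverse square roots *)

Lemma neumann x q : 0 <= q -> q < 1 -> nm x <= q -> st x = x ->
  exists l, [/\ st l = l, (1 - x) * l = 1 & forall z, z * x = x * z -> z * l = l * z].
Proof.
move=> q0 q1 xq xs.
pose y := fix y n : B := if n is m.+1 then 1 + x * y m else 0.
pose s := fix s n : R := if n is m.+1 then 1 + q * s m else 0.
have yS n : y n.+1 = 1 + x * y n by [].
have sS n : s n.+1 = 1 + q * s n by [].
have yC n z : z * x = x * z -> z * y n = y n * z.
  move=> zx; elim: n => [|n IH]; first by rewrite mulr0 mul0r.
  by rewrite yS mulrDr mulrDl mulr1 mul1r mulrA zx -!mulrA IH.
have ysa n : st (y n) = y n.
  elim: n => [|n IH]; first exact: st0.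
  by rewrite yS stD st1 stM IH xs yC.
have dy n : nm (y n.+1 - y n) <= s n.+1 - s n.
  elim: n => [|n IH]; first by rewrite /= !mulr0 !addr0 !subr0 nm1.
  rewrite (yS n.+1) [X in nm (_ - X)](yS n) (sS n.+1) [X in _ <= _ - X](sS n).
  rewrite opprD addrACA subrr add0r -mulrBr [leRHS](_ : _ = q * (s n.+1 - s n)); last by ring.
  by apply: (le_trans (nmM _ _)); apply: ler_pM.
have sM n : s n <= (1 - q)^-1.
  have u : 0 < 1 - q by lra.
  elim: n => [|n IH]; first by rewrite invr_ge0 ltW.
  rewrite sS; have := ler_wpM2l q0 IH; move: (mulVf (lt0r_neq0 u)).
  set v := (1 - q)^-1; lra.
have [l yl] := tends_majorant dy sM.
exists l; split.
- exact: tends_sa yl ysa.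
- apply/eqP; rewrite -subr_eq0; apply/eqP; apply: (@nm_small_eq0 _ 2) => e e0.
  have [N yN] := yl e e0.
  have -> : (1 - x) * l - 1 = x * (y N - l) - (y N.+1 - l).
    rewrite yS mulrBl mul1r mulrBr opprB opprD; set a := x * y N; set b := x * l.
    rewrite (addrC (- 1)) (addrA l) [RHS]addrA; congr (_ - 1).
    by rewrite (addrC a) addrACA subrr addr0 addrC.
  have a1 := yN _ (leqnSn N); have a2 := yN _ (leqnn N).
  rewrite (le_trans (nmD _ _)) // nmN.
  have : nm (x * (y N - l)) <= 1 * e.
    rewrite (le_trans (nmM _ _)) //; apply: ler_pM => //; last exact: ltW.
    exact: le_trans xq (ltW q1).
  by move: a1; set u := nm _; set v := nm _; move=> *; lra.
- by move=> z zx; apply: tends_comm yl _ => n; apply: yC.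
Qed.

(** Here [t] is [(h + e)^(-1/2)], obtained as the inverse [i] of [h + e] times its root [g].
    Dividing [h + e] by [c = nm h + e] gives [1 - x] with [nm x <= nm h / c < 1], so the Neumann
    series applies. *)
Lemma inv_sqrt_add h e : pos h -> 0 < e ->
  exists t, [/\ st t = t, h * t = t * h & t * t * (h + sc e) = 1].
Proof.
move=> ph e0; have hs := pos_sa ph.
pose c := nm h + e; have c0 : 0 < c by rewrite ltr_wpDl.
pose x := sc c^-1 * (sc (nm h) - h).
have ch : 1 - x = sc c^-1 * (h + sc e).
  rewrite /x mulrBr opprB mulrDr [RHS]addrC addrCA addrC; congr (_ + _).
  rewrite -!rmorphM -(rmorph1 sc) -rmorphB /=; congr sc.
  by rewrite -(mulVf (lt0r_neq0 c0)) /c; ring.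
have q1 : nm h / c < 1 by rewrite ltr_pdivrMr // mul1r /c ltrDl.
have hn : nm (sc (nm h) - h) <= nm h.
  apply: pos_le; first exact: pos_sc_sub.
  by rewrite opprB addrC subrK.
have q0 : 0 <= nm h / c by rewrite divr_ge0 // ltW.
have [||l [ls lx lc]] := neumann (x := x) q0 q1.
- by rewrite /x nm_scM gtr0_norm ?invr_gt0 // mulrC ler_pM2r ?invr_gt0.
- by rewrite /x stM st_sc stB st_sc hs sc_comm.
have ph' : pos (h + sc e) by apply: posD => //; apply: pos_sc; exact: ltW.
have [g [pg gg gc]] := pos_sqrt ph'.
pose i := sc c^-1 * l.
have hl : h * l = l * h.
  apply: lc; rewrite /x mulrA sc_comm -!mulrA; congr (_ * _).
  by rewrite mulrBr mulrBl sc_comm.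
have hi : h * i = i * h by rewrite /i mulrA sc_comm -!mulrA hl.
have his : i * (h + sc e) = (h + sc e) * i.
  by rewrite mulrDr mulrDl hi sc_comm.
have ig := gc _ his.
have ii : i * (h + sc e) = 1.
  by rewrite his /i mulrA sc_comm -ch lx.
have hg : h * g = g * h by apply: gc; rewrite mulrDr mulrDl sc_comm.
exists (i * g); split.
- by rewrite stM (pos_sa pg) stM ls st_sc sc_comm -/i ig.
- by rewrite mulrA hi -!mulrA hg.
- have igg : i * g * (h + sc e) = g by rewrite -gg -(mulrA i) (mulrA g g g) mulrA gg ii mul1r.
  by rewrite -mulrA igg -mulrA gg ii.
Qed.

(** Since [t^2 (h + e) = 1] and [t] commutes with [h], one has [t h t = 1 - e t^2 <= 1], and the
    error [h - h t^2 h] equals [e (t h t)]. *)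
Lemma approx_inv_sqrt h e : pos h -> 0 < e ->
  exists t, [/\ st t = t, nm (t * h * t) <= 1 & nm (h - h * t * t * h) <= e].
Proof.
move=> ph e0; have [t [ts ht tt]] := inv_sqrt_add ph e0.
have pb : pos (t * h * t) by rewrite -{1}ts; exact: pos_conj.
have tth : t * t * h + sc e * (t * t) = 1 by rewrite -sc_comm -mulrDr.
have thtE : t * h * t = t * t * h by rewrite -mulrA ht mulrA.
have b1 : nm (t * h * t) <= 1.
  apply: pos_le => //; rewrite rmorph1 -tth thtE addrAC subrr add0r.
  by apply: pos_scM; [exact: ltW|exact: pos_sqr].
exists t; split=> //.
have -> : h - h * t * t * h = sc e * (t * h * t).
  have -> : h * t * t * h = t * t * h * h by rewrite ht -(mulrA t) ht mulrA.
  rewrite -{1}(mul1r h) -{1}tth mulrDl addrAC subrr add0r thtE.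
  by rewrite !mulrA.
rewrite nm_scM gtr0_norm // -[leRHS]mulr1; apply: ler_wpM2l => //; exact: ltW.
Qed.

End UnitalCstar.

(** * Unitization *)

Section CompleteScalars.
Variable R : realType.

Lemma complete_real : complete_wrt (fun x : R => `|x|).
Proof.
move=> u uC.
(* The limit is found as the lower limit, the supremum of the eventual lower bounds. *)
pose S := [set x : R | exists N, forall n, (N <= n)%N -> x <= u n]%classic.
have near e : 0 < e -> exists N, [/\ S (u N - e), ubound S (u N + e) &
    forall n, (N <= n)%N -> `|u n - u N| < e].
  move=> e0; have [N uN] := uC e e0; exists N; split.
  - exists N => n Nn; have := uN n N Nn (leqnn N).
    by rewrite ltr_norml => /andP [? _]; lra.
  - move=> x [M xM].
    have := xM (maxn M N) (leq_maxl _ _); have := uN (maxn M N) N (leq_maxr _ _) (leqnn N).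
    by rewrite ltr_norml => /andP [_ ?]; lra.
  - by move=> n Nn; exact: uN.
have hS : has_sup S.
  have [N [a b _]] := near 1 ltr01.
  by split; [exists (u N - 1)|exists (u N + 1)].
exists (sup S) => e e0; have [|N [a b c]] := near (e / 2); first lra.
exists N => n /c; rewrite !ltr_norml => /andP [c1 c2].
have s1 : u N - e / 2 <= sup S by apply: ub_le_sup => //; case: hS.
have s2 : sup S <= u N + e / 2 by apply: sup_le_ub => //; case: hS.
by apply/andP; split; lra.
Qed.

Lemma cmod_le_ReIm (z : R[i]) : cmod z <= `|complex.Re z| + `|complex.Im z|.
Proof.
rewrite -(ler_pXn2r (n := 2)) ?nnegrE ?cmod_ge0 ?addr_ge0 //.
rewrite sqr_sqrtr ?addr_ge0 ?sqr_ge0 // sqrrD !real_normK ?num_real //.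
by rewrite -addrA lerD2l lerDr mulrn_wge0 // mulr_ge0.
Qed.

Lemma Re_le_cmod (z : R[i]) : `|complex.Re z| <= cmod z.
Proof. by rewrite -sqrtr_sqr ler_wsqrtr // lerDl sqr_ge0. Qed.

Lemma Im_le_cmod (z : R[i]) : `|complex.Im z| <= cmod z.
Proof. by rewrite -sqrtr_sqr ler_wsqrtr // lerDr sqr_ge0. Qed.

Lemma complete_cmod : complete_wrt (fun z : R[i]^o => cmod z).
Proof.
move=> u uC.
have [|a ua] := @complete_real (fun n => complex.Re (u n)).
  move=> e /uC [N uN]; exists N => m n Nm Nn; apply: le_lt_trans (uN m n Nm Nn).
  by rewrite -raddfB; exact: Re_le_cmod.
have [|b ub] := @complete_real (fun n => complex.Im (u n)).
  move=> e /uC [N uN]; exists N => m n Nm Nn; apply: le_lt_trans (uN m n Nm Nn).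
  by rewrite -raddfB; exact: Im_le_cmod.
exists (a +i* b) => e e0; have e20 : 0 < e / 2 by lra.
have [M uM] := ua _ e20; have [N uN] := ub _ e20.
exists (maxn M N) => n; rewrite geq_max => /andP [/uM un1 /uN un2].
apply: (le_lt_trans (cmod_le_ReIm _)).
by move: un1 un2; case: (u n) => c d /=; lra.
Qed.
End CompleteScalars.

(** The proof [HA] is carried by the type so that the algebra structure, whose laws rest on it, can
    be inferred from the type. *)
Definition unitization (R : realType) (A : lmodType R[i]) (mul : A -> A -> A)
  (star : A -> A) (nrm : A -> R) (HA : is_cstar_algebra mul star nrm) : Type :=
  (R[i]^o * A)%type.

Section Unitization.
Variables (R : realType) (A : lmodType R[i]) (mul : A -> A -> A).
Variables (star : A -> A) (nrm : A -> R) (HA : is_cstar_algebra mul star nrm).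
Local Notation U := (unitization HA).

HB.instance Definition _ := GRing.Lmodule.copy U (R[i]^o * A)%type.

Lemma cmul0r a : mul 0 a = 0.
Proof. by rewrite -(scale0r (0 : A)) (ca_mulZl HA) !scale0r. Qed.

Lemma cmulr0 a : mul a 0 = 0.
Proof. by rewrite -(scale0r (0 : A)) (ca_mulZr HA) !scale0r. Qed.

Lemma cstar0 : star 0 = 0.
Proof. by rewrite -(scale0r (0 : A)) (ca_starZ HA) conjc0 !scale0r. Qed.

Lemma cnrm0 : nrm 0 = 0.
Proof. by rewrite -(scale0r (0 : A)) (ca_nrmZ HA) cmod0 mul0r. Qed.

Lemma cnrm_star a : nrm (star a) = nrm a.
Proof.
have le b : nrm b <= nrm (star b).
  have := ca_nrm_ge0 HA b; rewrite le_eqVlt => /orP [/eqP <-|b0].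
    exact: (ca_nrm_ge0 HA).
  by rewrite -(ler_pM2r b0) -expr2 -(ca_cstar HA) (ca_nrmM HA).
by apply/eqP; rewrite eq_le le andbT -{2}(ca_starK HA a) le.
Qed.

(** The pair [(a, x)] stands for [a 1 + x]. *)
Definition umul (x y : U) : U :=
  (x.1 * y.1, x.1 *: y.2 + y.1 *: x.2 + mul x.2 y.2).
Definition uone : U := (1, 0).
Definition ust (x : U) : U := (conjc x.1, star x.2).

Lemma umulA : associative umul.
Proof.
move=> [a x] [b y] [c z]; rewrite /umul /= mulrA; congr pair.
rewrite !scalerDr !(ca_mulDl HA) !(ca_mulDr HA) !(ca_mulZl HA) !(ca_mulZr HA) (ca_mulA HA) !scalerA.
rewrite (mulrC c a) (mulrC c b) !addrA.
by rewrite [LHS](AC (7) (1*2*4*6*3*5*7)).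
Qed.

Lemma umul1 : left_id uone umul.
Proof. by move=> [a x]; rewrite /umul /= mul1r scale1r scaler0 addr0 cmul0r addr0. Qed.

Lemma umulr1 : right_id uone umul.
Proof. by move=> [a x]; rewrite /umul /= mulr1 scale1r scaler0 add0r cmulr0 addr0. Qed.

Lemma umulDl : left_distributive umul +%R.
Proof.
move=> [a x] [b y] [c z]; rewrite /umul /=; congr pair; first exact: mulrDl.
by rewrite scalerDl scalerDr (ca_mulDl HA) [X in X + _ = _]addrACA; exact: addrACA.
Qed.

Lemma umulDr : right_distributive umul +%R.
Proof.
move=> [a x] [b y] [c z]; rewrite /umul /=; congr pair; first exact: mulrDr.
by rewrite scalerDl scalerDr (ca_mulDr HA) [X in X + _ = _]addrACA; exact: addrACA.
Qed.

Lemma uone_neq0 : uone != 0.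
Proof. by apply/eqP => -[/eqP]; rewrite oner_eq0. Qed.

HB.instance Definition _ := GRing.Zmodule_isNzRing.Build U
  umulA umul1 umulr1 umulDl umulDr uone_neq0.

Lemma uscalerAl (k : R[i]) (x y : U) : k *: (x * y) = (k *: x) * y.
Proof.
case: x y => [a x] [b y]; congr pair => /=; first exact: mulrA.
by rewrite !scalerDr !scalerA (ca_mulZl HA) (mulrC k b).
Qed.

Lemma uscalerAr (k : R[i]) (x y : U) : k *: (x * y) = x * (k *: y).
Proof.
case: x y => [a x] [b y]; congr pair => /=; first exact: mulrCA.
by rewrite !scalerDr !scalerA (ca_mulZr HA) (mulrC a k).
Qed.

HB.instance Definition _ := GRing.Lmodule_isLalgebra.Build R[i] U uscalerAl.
HB.instance Definition _ := GRing.Lalgebra_isAlgebra.Build R[i] U uscalerAr.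

(** * Left multiplication on [A] and its operator norm *)

Definition lact (x : U) (b : A) : A := x.1 *: b + mul x.2 b.

Lemma lactM (x y : U) b : lact (x * y) b = lact x (lact y b).
Proof.
rewrite /lact /= scalerDr (ca_mulDr HA) !(ca_mulDl HA) !(ca_mulZl HA) (ca_mulZr HA).
by rewrite (ca_mulA HA) scalerA -!addrA; congr (_ + _); rewrite addrCA !addrA.
Qed.

Lemma lactD (x y : U) b : lact (x + y) b = lact x b + lact y b.
Proof. by rewrite /lact /= scalerDl (ca_mulDl HA) addrACA. Qed.

Lemma lactZ (k : R[i]) (x : U) b : lact (k *: x) b = k *: lact x b.
Proof. by rewrite /lact /= scalerDr scalerA (ca_mulZl HA). Qed.

Lemma lactZr (k : R[i]) (x : U) b : lact x (k *: b) = k *: lact x b.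
Proof. by rewrite /lact /= scalerDr !scalerA mulrC (ca_mulZr HA). Qed.

(** For the inner product [b^* c] on [A], the involution of the unitization is the adjoint; this is
    what yields the C-star identity for [opn]. *)
Lemma lact_adj (x : U) b c : mul (star (lact x b)) c = mul (star b) (lact (ust x) c).
Proof.
rewrite /lact /= (ca_starD HA) (ca_mulDl HA) (ca_mulDr HA) (ca_starZ HA) (ca_mulZl HA).
by rewrite (ca_mulZr HA) (ca_starM HA) (ca_mulA HA).
Qed.

Definition opn_set (x : U) := [set r : R | exists2 b, nrm b <= 1 & r = nrm (lact x b)]%classic.
Definition opn (x : U) : R := sup (opn_set x).

Lemma nrm_lact_le (x : U) b : nrm (lact x b) <= (cmod x.1 + nrm x.2) * nrm b.
Proof.
rewrite (le_trans (ca_nrmD HA _ _)) // (ca_nrmZ HA) mulrDl lerD //.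
exact: (ca_nrmM HA).
Qed.

Lemma opn_set_has_sup x : has_sup (opn_set x).
Proof.
split; first by exists (nrm (lact x 0)), 0 => //; rewrite cnrm0 ler01.
exists (cmod x.1 + nrm x.2) => _ [b b1 ->]; rewrite (le_trans (nrm_lact_le _ _)) //.
by rewrite -[leRHS]mulr1 ler_wpM2l // addr_ge0 ?cmod_ge0 // (ca_nrm_ge0 HA).
Qed.

Lemma opn_ge0 x : 0 <= opn x.
Proof.
apply: (le_trans (ca_nrm_ge0 HA (lact x 0))).
by apply: ub_le_sup; [case: (opn_set_has_sup x)|exists 0; rewrite // cnrm0 ler01].
Qed.

Lemma opn_lact x b : nrm (lact x b) <= opn x * nrm b.
Proof.
have := ca_nrm_ge0 HA b; rewrite le_eqVlt => /orP [/eqP b0|b0].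
  by have := nrm_lact_le x b; rewrite -b0 !mulr0.
rewrite -ler_pdivrMr //.
have -> : nrm (lact x b) / nrm b = nrm (lact x ((nrm b)^-1%:C *: b)).
  by rewrite lactZr (ca_nrmZ HA) cmod_real ger0_norm ?invr_ge0 ?ltW // mulrC.
apply: ub_le_sup; first by case: (opn_set_has_sup x).
exists ((nrm b)^-1%:C *: b) => //.
by rewrite (ca_nrmZ HA) cmod_real gtr0_norm ?invr_gt0 // mulVf ?gt_eqF.
Qed.

Lemma opn_le x K : 0 <= K -> (forall b, nrm (lact x b) <= K * nrm b) -> opn x <= K.
Proof.
move=> K0 xK; apply: sup_le_ub; first by case: (opn_set_has_sup x).
by move=> _ [b b1 ->]; rewrite (le_trans (xK b)) // -[leRHS]mulr1 ler_wpM2l.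
Qed.

Lemma opnD x y : opn (x + y) <= opn x + opn y.
Proof.
apply: opn_le => [|b]; first by rewrite addr_ge0 ?opn_ge0.
rewrite lactD mulrDl (le_trans (ca_nrmD HA _ _)) // lerD //; exact: opn_lact.
Qed.

Lemma opnM x y : opn (x * y) <= opn x * opn y.
Proof.
apply: opn_le => [|b]; first by rewrite mulr_ge0 ?opn_ge0.
rewrite lactM (le_trans (opn_lact _ _)) // -mulrA ler_wpM2l ?opn_ge0 //.
exact: opn_lact.
Qed.

Lemma opnZ (k : R[i]) x : opn (k *: x) = cmod k * opn x.
Proof.
have le (c : R[i]) y : opn (c *: y) <= cmod c * opn y.
  apply: opn_le => [|b]; first by rewrite mulr_ge0 ?opn_ge0 ?cmod_ge0.
  by rewrite lactZ (ca_nrmZ HA) -mulrA ler_wpM2l ?cmod_ge0 // opn_lact.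
apply/eqP; rewrite eq_le le /=.
have [->|k0] := eqVneq k 0; first by rewrite cmod0 mul0r opn_ge0.
have := le k^-1 (k *: x); rewrite scalerA mulVf // scale1r => /(ler_wpM2l (cmod_ge0 k)).
by rewrite mulrA -cmodM mulfV // cmod1 mul1r.
Qed.

Lemma ustK : involutive ust.
Proof. by move=> [a x]; rewrite /ust /= conjcK (ca_starK HA). Qed.

Lemma opn_cstar_le x : opn x ^+ 2 <= opn (ust x * x).
Proof.
have s0 := opn_ge0 (ust x * x).
rewrite -[leRHS]sqr_sqrtr // ler_pXn2r ?nnegrE ?opn_ge0 ?sqrtr_ge0 //.
apply: opn_le => [|b]; first exact: sqrtr_ge0.
have b0 := ca_nrm_ge0 HA b.
rewrite -(ler_pXn2r (n := 2)) ?nnegrE ?mulr_ge0 ?sqrtr_ge0 ?(ca_nrm_ge0 HA) //.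
rewrite exprMn sqr_sqrtr // -(ca_cstar HA) lact_adj -lactM.
rewrite (le_trans (ca_nrmM HA _ _)) // cnrm_star expr2 mulrA mulrC ler_wpM2r //.
exact: opn_lact.
Qed.

Lemma opn_ust x : opn (ust x) = opn x.
Proof.
have le y : opn y <= opn (ust y).
  have := opn_ge0 y; rewrite le_eqVlt => /orP [/eqP <-|y0]; first exact: opn_ge0.
  rewrite -(ler_pM2r y0) -expr2; exact: le_trans (opn_cstar_le _) (opnM _ _).
by apply/eqP; rewrite eq_le le andbT -{2}(ustK x) le.
Qed.

Lemma opn_cstar x : opn (ust x * x) = opn x ^+ 2.
Proof.
by apply/eqP; rewrite eq_le opn_cstar_le andbT expr2 -{1}(opn_ust x) opnM.
Qed.

Definition embed (a : A) : U := (0, a).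

(** Left multiplication by [a] attains the bound [nrm a] at the vector [star a]. *)
Lemma opn_embed a : opn (embed a) = nrm a.
Proof.
have lE b : lact (embed a) b = mul a b by rewrite /lact scale0r add0r.
apply/eqP; rewrite eq_le; apply/andP; split.
  apply: opn_le => [|b]; first exact: (ca_nrm_ge0 HA).
  by rewrite lE; exact: (ca_nrmM HA).
have [a0|] := ltP 0 (nrm a); last by move=> /le_trans; apply; exact: opn_ge0.
rewrite -(ler_pM2r a0) -expr2 -cnrm_star -(ca_cstar HA) (ca_starK HA) -lE.
exact: opn_lact.
Qed.

(* The character norm [cmod x.1] makes this a norm even when [A] is itself unital. *)
Definition unm (x : U) : R := Num.max (cmod x.1) (opn x).

Lemma cmod_le_unm (x : U) : cmod x.1 <= unm x.
Proof. by rewrite le_max lexx. Qed.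

Lemma opn_le_unm (x : U) : opn x <= unm x.
Proof. by rewrite le_max lexx orbT. Qed.

(** The second coordinate is [x] minus the scalar [x.1]. With [cmod_le_unm] this controls both
    coordinates, which gives definiteness and completeness of [unm]. *)
Lemma nrm_le_unm (x : U) : nrm x.2 <= unm x + unm x.
Proof.
have e : embed x.2 = x + (- x.1) *: (1 : U).
  by case: x => a x; congr pair => /=; rewrite ?scaler0 ?addr0 // [_ *: _]mulr1 subrr.
rewrite -opn_embed e (le_trans (opnD _ _)) // lerD ?opn_le_unm //.
apply: le_trans (cmod_le_unm x); rewrite opnZ -scaleN1r cmodM cmodN1 mul1r.
rewrite -[leRHS]mulr1 ler_wpM2l ?cmod_ge0 //; apply: opn_le => // b.
by rewrite /lact /= scale1r cmul0r addr0 mul1r.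
Qed.

Lemma unm_le_add (x : U) : unm x <= cmod x.1 + nrm x.2.
Proof.
have n0 := ca_nrm_ge0 HA x.2.
rewrite ge_max lerDl n0 /=; apply: opn_le; first by rewrite addr_ge0 ?cmod_ge0.
exact: nrm_lact_le.
Qed.

Lemma unitization_cstar : is_cstar_algebra (A := U) *%R ust unm.
Proof.
split.
- exact: mulrA.
- exact: mulrDl.
- exact: mulrDr.
- by move=> k a b; rewrite scalerAl.
- by move=> k a b; rewrite scalerAr.
- by move=> [a x] [b y]; congr pair => /=; rewrite ?rmorphD ?(ca_starD HA).
- by move=> k [a x]; congr pair => /=; rewrite ?rmorphM ?(ca_starZ HA).
- exact: ustK.
- move=> [a x] [b y]; congr pair => /=; first by rewrite rmorphM mulrC.
  rewrite !(ca_starD HA) !(ca_starZ HA) (ca_starM HA); congr (_ + _); exact: addrC.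
- by move=> x; rewrite (le_trans (cmod_ge0 _) (cmod_le_unm x)).
- move=> [a x] u0.
  have a0 : a = 0.
    by apply: cmod_eq0; apply/eqP; rewrite eq_le cmod_ge0 -u0 (cmod_le_unm (a, x)).
  have x0 : x = 0.
    apply: (ca_nrm_eq0 HA); apply/eqP; rewrite eq_le (ca_nrm_ge0 HA) andbT.
    by have := nrm_le_unm (a, x); rewrite u0 addr0.
  by rewrite a0 x0.
- by move=> k x; rewrite /unm opnZ cmodM -maxr_pMr ?cmod_ge0.
- move=> x y; rewrite ge_max; apply/andP; split.
    by rewrite (le_trans (cmodD _ _)) // lerD ?cmod_le_unm.
  by rewrite (le_trans (opnD _ _)) // lerD ?opn_le_unm.
- move=> x y; rewrite ge_max; apply/andP; split.
    by rewrite cmodM ler_pM ?cmod_ge0 ?cmod_le_unm.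
  by rewrite (le_trans (opnM _ _)) // ler_pM ?opn_ge0 ?opn_le_unm.
- move=> u uC.
  have [|a ua] := @complete_cmod R (fun n => (u n).1).
    move=> e /uC [N uN]; exists N => m n Nm Nn; apply: le_lt_trans (uN m n Nm Nn).
    exact: (cmod_le_unm (u m - u n)).
  have [|x ux] := ca_complete HA (u := fun n => (u n).2).
    move=> e e0; have [|N uN] := uC (e / 2); first lra.
    exists N => m n Nm Nn; have := nrm_le_unm (u m - u n); have := uN m n Nm Nn.
    by rewrite /=; lra.
  exists (a, x) => e e0; have e20 : 0 < e / 2 by lra.
  have [M uM] := ua _ e20; have [N uN] := ux _ e20.
  exists (maxn M N) => n; rewrite geq_max => /andP [/uM un1 /uN un2].
  by have := unm_le_add (u n - (a, x)); rewrite /=; lra.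
(* Both seminorms satisfy the C-star identity, and squaring commutes with the maximum of nonnegative
   numbers. *)
- move=> x; rewrite /unm opn_cstar cmodM cmod_conj -expr2.
  have c0 := cmod_ge0 x.1; have o0 := opn_ge0 x.
  case: (leP (cmod x.1) (opn x)) => h.
    by apply/max_idPr; rewrite ler_pXn2r ?nnegrE.
  by apply/max_idPl; rewrite ler_pXn2r ?nnegrE // ltW.
Qed.

Lemma embedD a b : embed (a + b) = embed a + embed b.
Proof. by congr pair; rewrite /= addr0. Qed.

Lemma embedM a b : embed (mul a b) = embed a * embed b.
Proof. by congr pair; rewrite /= ?mulr0 // !scale0r !add0r. Qed.

Lemma embed_star a : embed (star a) = ust (embed a).
Proof. by congr pair; rewrite rmorph0. Qed.

Lemma embedI : injective embed.
Proof. by move=> a b []. Qed.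

Lemma unm_embed a : unm (embed a) = nrm a.
Proof. by rewrite /unm opn_embed cmod0; apply/max_idPr; exact: (ca_nrm_ge0 HA). Qed.

Lemma embed_snd (x : U) : x.1 = 0 -> x = embed x.2.
Proof. by case: x => a x /= ->. Qed.

(** The first coordinate is a character, so a square root of an element of [A] lies in [A]. *)
Lemma sqr_fst0 (x : U) : (x * x).1 = 0 -> x.1 = 0.
Proof. by move=> /eqP; rewrite mulf_eq0 orbb => /eqP. Qed.

End Unitization.

(** * Hilbert modules *)

Section CstarPositivity.
Variables (R : realType) (A : lmodType R[i]) (mul : A -> A -> A).
Variables (star : A -> A) (nrm : A -> R) (HA : is_cstar_algebra mul star nrm).

Let HU := unitization_cstar HA.
Local Notation j := (embed HA).

Definition psd (a : A) : Prop := pos (@ust _ _ _ _ _ HA) (@unm _ _ _ _ _ HA) (j a).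

Lemma embedN a : j (- a) = - j a.
Proof. by congr pair; rewrite oppr0. Qed.

Lemma embedB a b : j (a - b) = j a - j b.
Proof. by rewrite embedD embedN. Qed.

Lemma embed_real (r : R) a : j (r%:C *: a) = sc _ r * j a.
Proof. by rewrite sc_mulE; congr pair; rewrite /= scaler0. Qed.

Lemma psd_sqr a : psd (mul (star a) a).
Proof. by rewrite /psd embedM embed_star; exact: (pos_star_mul HU). Qed.

Lemma psd_cpos a : cpos mul star a -> psd a.
Proof. by move=> [b ->]; exact: psd_sqr. Qed.

Lemma psd0 : psd 0.
Proof. by rewrite -(cmulr0 HA (star 0)); exact: psd_sqr. Qed.

Lemma psdD a b : psd a -> psd b -> psd (a + b).
Proof. by rewrite /psd embedD; exact: (posD HU). Qed.

Lemma psd_sum (I : Type) (r : seq I) (P : pred I) (F : I -> A) :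
  (forall i, P i -> psd (F i)) -> psd (\sum_(i <- r | P i) F i).
Proof. by move=> FP; elim/big_ind: _ => //; [exact: psd0|exact: psdD]. Qed.

Lemma psdZ (r : R) a : 0 <= r -> psd a -> psd (r%:C *: a).
Proof. by rewrite /psd embed_real; exact: (pos_scM HU). Qed.

Lemma psd_mono a b : psd a -> psd (b - a) -> nrm a <= nrm b.
Proof. by rewrite /psd embedB -!(unm_embed HA); exact: (nm_mono HU). Qed.

Lemma embed_pos_sqrt k : pos (@ust _ _ _ _ _ HA) (@unm _ _ _ _ _ HA) k -> k.1 = 0 ->
  exists b, [/\ star b = b, psd b & k = j (mul b b)].
Proof.
move=> pk k0; have [m [pm mm _]] := pos_sqrt HU pk.
have m0 : m.1 = 0 by apply: sqr_fst0; rewrite mm.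
rewrite (embed_snd m0) in pm mm; exists m.2; split=> //.
  by apply: (@embedI _ _ _ _ _ HA); rewrite embed_star; exact: (pos_sa pm).
by rewrite embedM.
Qed.

(** The root is taken twice: a self-adjoint root [c] of [b] exhibits [b] in the form [c^* c] that
    [cpos] demands. *)
Lemma psd_sqrt_ex a : psd a -> exists b, cpos mul star b /\ mul b b = a.
Proof.
move=> pa; have [b [_ pb e]] := embed_pos_sqrt pa erefl.
have [c [sc_ _ e']] := embed_pos_sqrt pb erefl.
exists b; split; last by apply: (@embedI _ _ _ _ _ HA).
by exists c; rewrite sc_; apply: (@embedI _ _ _ _ _ HA).
Qed.

Lemma csqrtP a : psd a -> cpos mul star (csqrt mul star a) /\
  mul (csqrt mul star a) (csqrt mul star a) = a.
Proof. by move=> /psd_sqrt_ex; exact: epsilon_spec. Qed.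

Lemma nrm_csqrt a : psd a -> nrm (csqrt mul star a) = Num.sqrt (nrm a).
Proof.
move=> /csqrtP [[c cE] {2}<-].
have s : star (csqrt mul star a) = csqrt mul star a.
  by rewrite cE (ca_starM HA) (ca_starK HA).
by rewrite -{2}s (ca_cstar HA) sqrtr_sqr ger0_norm ?(ca_nrm_ge0 HA).
Qed.

Lemma cabs_sqr a : mul (cabs mul star a) (cabs mul star a) = mul (star a) a.
Proof. by have [] := csqrtP (psd_sqr a). Qed.

Lemma psd_cauchy_schwarz E F G : psd E -> nrm E <= 1 ->
  psd (F - mul (star G) G - mul (star G) G + mul (mul (star G) E) G) ->
  psd (F - mul (star G) G).
Proof.
rewrite /psd !embedD !embedN !embedM !embed_star -(unm_embed HA).
exact: (pos_cauchy_schwarz HU).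
Qed.

(* [(a, b)] approximates [(u, v)] times the inverse square root of [u* u + v* v]. *)
Lemma approx_polar u v e : 0 < e -> exists a b,
  nrm (mul (star a) a + mul (star b) b) <= 1 /\
  let w := mul (star a) u + mul (star b) v in
  nrm (mul (star u) u + mul (star v) v - mul (star w) w) <= e.
Proof.
move=> e0; pose h := mul (star u) u + mul (star v) v.
have ph : psd h by apply: psdD; exact: psd_sqr.
have [t [ts t1 te]] := approx_inv_sqrt HU ph e0.
(* The element [t] lives in the unitization, but [A] is an ideal, so [u t] and [v t] are elements of
   [A]. *)
have fst0 c : (j c * t).1 = 0 by rewrite [LHS]mul0r.
have emb c : j ((j c * t).2) = j c * t by rewrite -embed_snd.
have embs c : j (star (j c * t).2) = t * j (star c).
  by rewrite embed_star emb (ca_starM HU) ts embed_star.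
have jh : j h = j (star u) * j u + j (star v) * j v by rewrite embedD !embedM.
exists (j u * t).2, (j v * t).2.
(* With [a = u t] and [b = v t], the sum [a^* a + b^* b] is [t h t] and [w] is [t h], so the two
   bounds on [t] are the two claims. *)
have hE : t * j h * t = j (mul (star (j u * t).2) (j u * t).2 +
                           mul (star (j v * t).2) (j v * t).2).
  by rewrite [RHS]embedD 2![in RHS]embedM !embs !emb jh mulrDr mulrDl !mulrA.
split=> [|w]; first by rewrite -(unm_embed HA) -hE.
have wE : j w = t * j h.
  by rewrite [LHS]embedD 2![in LHS]embedM !embs jh mulrDr !mulrA.
rewrite -(unm_embed HA) embedB embedM embed_star wE (ca_starM HU) ts.
by rewrite (pos_sa ph) mulrA.
Qed.

End CstarPositivity.

(** * Cauchy-Schwarz for inner products, on [X] and on families in [A] alike *)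

Section InnerProduct.
Variables (R : realType) (A : lmodType R[i]) (mul : A -> A -> A).
Variables (star : A -> A) (nrm : A -> R) (HA : is_cstar_algebra mul star nrm).
Variables (V : lmodType R[i]) (act : V -> A -> V) (ip : V -> V -> A).

Hypothesis ipDr : forall x y z, ip x (y + z) = ip x y + ip x z.
Hypothesis ipZr : forall (k : R[i]) x y, ip x (k *: y) = k *: ip x y.
Hypothesis ipM : forall x y a, ip x (act y a) = mul (ip x y) a.
Hypothesis ip_star : forall x y, ip y x = star (ip x y).
Hypothesis ip_psd : forall x, psd HA (ip x x).

Lemma ipDl x y z : ip (x + y) z = ip x z + ip y z.
Proof. by rewrite ip_star ipDr (ca_starD HA) -!ip_star. Qed.

Lemma ipZl (k : R[i]) x y : ip (k *: x) y = conjc k *: ip x y.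
Proof. by rewrite ip_star ipZr (ca_starZ HA) -ip_star. Qed.

Lemma ipMl x y a : ip (act x a) y = mul (star a) (ip x y).
Proof. by rewrite ip_star ipM (ca_starM HA) -ip_star. Qed.

Lemma ipNr x y : ip x (- y) = - ip x y.
Proof. by rewrite -scaleN1r ipZr scaleN1r. Qed.

Lemma ipNl x y : ip (- x) y = - ip x y.
Proof. by rewrite -scaleN1r ipZl rmorphN1 scaleN1r. Qed.

Lemma ip_cauchy_schwarz_psd e f : nrm (ip e e) <= 1 ->
  psd HA (ip f f - mul (star (ip e f)) (ip e f)).
Proof.
move=> e1; apply: (psd_cauchy_schwarz (ip_psd e) e1).
have := ip_psd (f - act e (ip e f)).
rewrite ipDr !ipDl !ipNr !ipNl !ipM !ipMl (ip_star e f) opprK.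
by rewrite addrA.
Qed.

Lemma cmod_conjM (k : R[i]) : conjc k * k = (cmod k ^+ 2)%:C.
Proof.
case: k => a b; rewrite /cmod sqr_sqrtr ?addr_ge0 ?sqr_ge0 //=.
by apply/eqP; rewrite eq_complex /=; apply/andP; split; apply/eqP; ring.
Qed.

Lemma nrm_ipZ (k : R[i]) x : nrm (ip (k *: x) (k *: x)) = cmod k ^+ 2 * nrm (ip x x).
Proof. by rewrite ipZr ipZl scalerA mulrC cmod_conjM (ca_nrmZ HA) cmod_real ger0_norm ?sqr_ge0. Qed.

Lemma ip_cauchy_schwarz e f :
  nrm (ip e f) ^+ 2 <= nrm (ip e e) * nrm (ip f f).
Proof.
have E0 := ca_nrm_ge0 HA (ip e e); have F0 := ca_nrm_ge0 HA (ip f f).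
(* Normalizing [e] divides by a bound [K] that must be positive, whereas [nrm (ip e e)] may vanish;
   [K] is then let down to it. *)
have scaled K : 0 < K -> nrm (ip e e) <= K -> nrm (ip e f) ^+ 2 <= K * nrm (ip f f).
  move=> K0 EK; pose r := Num.sqrt K^-1.
  have r2 : r ^+ 2 = K^-1 by rewrite sqr_sqrtr // invr_ge0 ltW.
  have r0 : 0 <= r by exact: sqrtr_ge0.
  have n1 : nrm (ip (r%:C *: e) (r%:C *: e)) <= 1.
    by rewrite nrm_ipZ cmod_real ger0_norm // r2 mulrC ler_pdivrMr // mul1r.
  have := psd_mono (psd_sqr HA _) (ip_cauchy_schwarz_psd f n1).
  rewrite (ca_cstar HA) ipZl conjc_real (ca_nrmZ HA) cmod_real ger0_norm // exprMn r2.
  by rewrite mulrC ler_pdivrMr // mulrC.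
apply/ler_addgt0Pr => d d0.
(* Exceeding [nrm (ip e e)] by [d / (nrm (ip f f) + 1)] costs at most [d] after multiplication by
   [nrm (ip f f)]. *)
have F1 : 0 < nrm (ip f f) + 1 by rewrite ltr_wpDl.
have D0 : 0 < d / (nrm (ip f f) + 1) by rewrite divr_gt0.
have := scaled (nrm (ip e e) + d / (nrm (ip f f) + 1)).
rewrite ltr_wpDl // lerDl ltW // => /(_ isT isT) /le_trans; apply.
rewrite mulrDl lerD2l mulrAC ler_pdivrMr // ler_wpM2l ?ltW //; lra.
Qed.

Lemma hnormE x : nrm (ip x x) = hnorm nrm ip x ^+ 2.
Proof. by rewrite sqr_sqrtr // (ca_nrm_ge0 HA). Qed.

Lemma nrm_ip_le e f : nrm (ip e f) <= hnorm nrm ip e * hnorm nrm ip f.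
Proof.
rewrite -(ler_pXn2r (n := 2)) ?nnegrE ?mulr_ge0 ?sqrtr_ge0 ?(ca_nrm_ge0 HA) //.
by rewrite exprMn -!hnormE; exact: ip_cauchy_schwarz.
Qed.

Lemma hnorm_triangle x y : hnorm nrm ip (x + y) <= hnorm nrm ip x + hnorm nrm ip y.
Proof.
have b := nrm_ip_le x y; have c := nrm_ip_le y x.
have hx : 0 <= hnorm nrm ip x := sqrtr_ge0 _.
have hy : 0 <= hnorm nrm ip y := sqrtr_ge0 _.
rewrite -(ler_pXn2r (n := 2)) ?nnegrE ?sqrtr_ge0 ?addr_ge0 // -hnormE.
rewrite ipDr !ipDl sqrrD -!hnormE.
apply: (le_trans (ca_nrmD HA _ _)).
apply: (le_trans (lerD (ca_nrmD HA _ _) (ca_nrmD HA _ _))).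
by move: b c; rewrite mulr2n; lra.
Qed.

Lemma hnormZ (k : R[i]) x : hnorm nrm ip (k *: x) = cmod k * hnorm nrm ip x.
Proof.
by rewrite /hnorm nrm_ipZ sqrtrM ?sqr_ge0 // sqrtr_sqr ger0_norm ?cmod_ge0.
Qed.

End InnerProduct.

(** * The inner product of finite families in [A] *)

Section FamilyInnerProduct.
Variables (R : realType) (A : lmodType R[i]) (mul : A -> A -> A).
Variables (star : A -> A) (nrm : A -> R) (HA : is_cstar_algebra mul star nrm).
Variable I : finType.

(** The index type is arbitrary: ordinals serve for the multi-norm, [bool] for columns with two
    entries. *)
Definition fip (f g : {ffun I -> A}) : A := \sum_i mul (star (f i)) (g i).
Definition fact (f : {ffun I -> A}) (a : A) : {ffun I -> A} := [ffun i => mul (f i) a].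

Lemma fipDr x y z : fip x (y + z) = fip x y + fip x z.
Proof. by rewrite -big_split; apply: eq_bigr => i _; rewrite ffunE (ca_mulDr HA). Qed.

Lemma fipZr (k : R[i]) x y : fip x (k *: y) = k *: fip x y.
Proof. by rewrite scaler_sumr; apply: eq_bigr => i _; rewrite ffunE (ca_mulZr HA). Qed.

Lemma cmul_suml (F : I -> A) a : mul (\sum_i F i) a = \sum_i mul (F i) a.
Proof.
by apply: (big_morph (fun b => mul b a)) => [b c|]; [exact: (ca_mulDl HA)|exact: (cmul0r HA)].
Qed.

Lemma fipM x y a : fip x (fact y a) = mul (fip x y) a.
Proof. by rewrite cmul_suml; apply: eq_bigr => i _; rewrite ffunE (ca_mulA HA). Qed.

Lemma fip_star x y : fip y x = star (fip x y).
Proof.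
rewrite (big_morph star (ca_starD HA) (cstar0 HA)); apply: eq_bigr => i _.
by rewrite (ca_starM HA) (ca_starK HA).
Qed.

Lemma fip_psd x : psd HA (fip x x).
Proof. by apply: psd_sum => i _; exact: psd_sqr. Qed.

End FamilyInnerProduct.

Arguments fip {R A} mul star {I} f g.
Arguments fact {R A} mul {I} f a.

(** * The multi-norm *)

Section HilbertModule.
Variables (R : realType) (A : lmodType R[i]) (mul : A -> A -> A).
Variables (star : A -> A) (nrm : A -> R) (HA : is_cstar_algebra mul star nrm).
Variables (X : lmodType R[i]) (act : X -> A -> X) (ip : X -> X -> A).
Hypothesis HX : is_hilbert_module mul star nrm act ip.

Local Notation hn := (hnorm nrm ip).
Local Notation fhn := (hnorm nrm (fip mul star)).
Local Notation mnorm x := (mnorm_star mul star nrm ip x).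

Let ip_psd x : psd HA (ip x x) := psd_cpos HA (hm_ip_pos HX x).
Let ipDr := hm_ipDr HX.
Let ipZr := hm_ipZr HX.
Let ip_star := hm_ip_star HX.
Let nrm_ge0 := ca_nrm_ge0 HA.
Let ip_le e f : nrm (ip e f) <= hn e * hn f :=
  nrm_ip_le ipDr ipZr (hm_ipM HX) ip_star ip_psd e f.
Let hnZ (k : R[i]) x : hn (k *: x) = cmod k * hn x := hnormZ HA ipZr ip_star k x.

Lemma hn_ge0 x : 0 <= hn x.
Proof. exact: sqrtr_ge0. Qed.

Lemma ip0r x : ip x 0 = 0.
Proof. by rewrite -(scale0r (0 : X)) ipZr scale0r. Qed.

Lemma ip0l x : ip 0 x = 0.
Proof. by rewrite ip_star ip0r (cstar0 HA). Qed.

Lemma hn0 : hn 0 = 0.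
Proof. by rewrite /hnorm ip0r (cnrm0 HA) sqrtr0. Qed.

Lemma hn_eq0 x : hn x = 0 -> x = 0.
Proof.
move=> x0; apply: (hm_ip_eq0 HX); apply: (ca_nrm_eq0 HA).
by rewrite (hnormE HA) x0 expr0n.
Qed.

(** The element under the norm in both [mu_star] and [mnorm_star], freed of the chosen roots by
    [cabs_sqr]. *)
Definition sumsq n (y x : 'I_n -> X) : A :=
  \sum_i mul (star (ip (y i) (x i))) (ip (y i) (x i)).

Lemma sumsqE n (y x : 'I_n -> X) :
  \sum_(i < n) mul (cabs mul star (ip (y i) (x i))) (cabs mul star (ip (y i) (x i)))
    = sumsq y x.
Proof. by apply: eq_bigr => i _; rewrite (cabs_sqr HA). Qed.

Lemma sumsq_fip n (y x : 'I_n -> X) :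
  sumsq y x = fip mul star [ffun i => ip (y i) (x i)] [ffun i => ip (y i) (x i)].
Proof. by apply: eq_bigr => i _; rewrite ffunE. Qed.

Lemma sqrt_sumsq n (y x : 'I_n -> X) :
  Num.sqrt (nrm (sumsq y x)) = fhn [ffun i => ip (y i) (x i)].
Proof. by rewrite sumsq_fip. Qed.

Lemma psd_sumsq n (y x : 'I_n -> X) : psd HA (sumsq y x).
Proof. by apply: psd_sum => i _; exact: psd_sqr. Qed.

Lemma nrm_sum (I : finType) (F : I -> A) : nrm (\sum_i F i) <= \sum_i nrm (F i).
Proof.
elim/big_ind2: _ => [|a r b s ar bs|i _] //; first by rewrite (cnrm0 HA).
by rewrite (le_trans (ca_nrmD HA _ _)) // lerD.
Qed.

Lemma nrm_sumsq_le n (y x : 'I_n -> X) (B : 'I_n -> R) :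
  (forall i, nrm (ip (y i) (x i)) <= B i) -> nrm (sumsq y x) <= \sum_i B i ^+ 2.
Proof.
move=> yB; apply: (le_trans (nrm_sum _)); apply: ler_sum => i _.
have Bi : 0 <= B i by apply: le_trans (yB i).
by rewrite (ca_cstar HA) ler_pXn2r ?nnegrE.
Qed.

Lemma nrm_ip_le_sumsq n (y x : 'I_n -> X) i :
  nrm (ip (y i) (x i)) ^+ 2 <= nrm (sumsq y x).
Proof.
rewrite -(ca_cstar HA); apply: (psd_mono (HA := HA)); first exact: psd_sqr.
rewrite /sumsq (bigD1 i) //= addrAC subrr add0r.
by apply: psd_sum => k _; exact: psd_sqr.
Qed.

(** * Contractive families, and the multi-norm as a supremum over them *)

Definition contr n (y : 'I_n -> X) : Prop :=
  forall z, hn z <= 1 -> nrm (sumsq y (fun=> z)) <= 1.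

Lemma mu_star_le1 n (y : 'I_n -> X) : mu_star mul star nrm ip y <= 1 <-> contr y.
Proof.
pose E := [set r : R | exists z : X, hn z <= 1 /\
  r = nrm (csqrt mul star (\sum_(i < n)
        mul (cabs mul star (ip (y i) z)) (cabs mul star (ip (y i) z))))]%classic.
have EP z : nrm (csqrt mul star (\sum_(i < n)
    mul (cabs mul star (ip (y i) z)) (cabs mul star (ip (y i) z)))) =
    Num.sqrt (nrm (sumsq y (fun=> z))).
  by rewrite (sumsqE y (fun=> z)) (nrm_csqrt (psd_sumsq _ _)).
(* The supremum of an unbounded set is [0] by default, so boundedness has to be known before
   [mu_star y <= 1] says anything about single vectors. *)
have hE : has_sup E.
  split; first by eexists; exists 0; split; [rewrite hn0|].
  exists (Num.sqrt (\sum_i hn (y i) ^+ 2)) => _ [z [z1 ->]]; rewrite EP.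
  apply: ler_wsqrtr; apply: nrm_sumsq_le => i; rewrite (le_trans (ip_le _ _)) //.
  by rewrite -[leRHS]mulr1 ler_wpM2l // hn_ge0.
rewrite /mu_star -/E; split=> [E1 z z1|yc].
  have : Num.sqrt (nrm (sumsq y (fun=> z))) <= 1.
    by apply: le_trans E1; apply: ub_le_sup; [case: hE|exists z; rewrite EP].
  by rewrite -(ler_pXn2r (n := 2)) ?nnegrE ?sqrtr_ge0 // sqr_sqrtr // expr1n.
apply: sup_le_ub; first by case: hE.
by move=> _ [z [z1 ->]]; rewrite EP -sqrtr1; apply: ler_wsqrtr; exact: yc.
Qed.

(** One term is at most the whole sum, and scaling handles vectors outside the unit ball. Bounds the
    supremum in [mnorm_star] and gives its value for [n = 1]. *)
Lemma contr_ip_le n (y : 'I_n -> X) i z : contr y -> nrm (ip (y i) z) <= hn z.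
Proof.
move=> yc; have [z0|z0] := eqVneq (hn z) 0.
  by rewrite (hn_eq0 z0) ip0r (cnrm0 HA) hn0.
have zp : 0 < hn z by rewrite lt0r z0 hn_ge0.
have c : cmod ((hn z)^-1%:C) = (hn z)^-1 by rewrite cmod_real gtr0_norm ?invr_gt0.
have := yc ((hn z)^-1%:C *: z); rewrite hnZ c mulVf // lexx => /(_ isT).
move=> /(le_trans (nrm_ip_le_sumsq _ _ i)).
rewrite ipZr (ca_nrmZ HA) c -(expr1n R 2) ler_pXn2r ?nnegrE ?mulr_ge0 ?invr_ge0 ?hn_ge0 //.
by rewrite mulrC ler_pdivrMr // mul1r.
Qed.

Lemma contr0 n : contr (fun _ : 'I_n => 0).
Proof.
move=> z _; rewrite /sumsq big1 ?(cnrm0 HA) // => i _.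
by rewrite ip0l (cmulr0 HA).
Qed.

Lemma mnormE n (x : 'I_n -> X) :
  mnorm x = sup [set fhn [ffun i => ip (y i) (x i)] | y in contr (n := n)]%classic.
Proof.
congr sup; apply/seteqP; split=> r /=.
  by move=> [y [/mu_star_le1 yc ->]]; exists y; rewrite // sumsqE sqrt_sumsq.
by move=> [y yc <-]; exists y; rewrite sumsqE sqrt_sumsq; split=> //; apply/mu_star_le1.
Qed.

Lemma mnorm_ub n (y x : 'I_n -> X) : contr y -> fhn [ffun i => ip (y i) (x i)] <= mnorm x.
Proof.
move=> yc; rewrite mnormE; apply: ub_le_sup; last by exists y.
exists (Num.sqrt (\sum_i hn (x i) ^+ 2)) => _ [w wc <-]; rewrite -sqrt_sumsq.
by apply: ler_wsqrtr; apply: nrm_sumsq_le => i; exact: contr_ip_le.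
Qed.

Lemma mnorm_le n (x : 'I_n -> X) K :
  (forall y, contr y -> fhn [ffun i => ip (y i) (x i)] <= K) -> mnorm x <= K.
Proof.
move=> xK; rewrite mnormE; apply: sup_le_ub; last by move=> _ [y yc <-]; exact: xK.
by eexists; exists (fun=> 0); [exact: contr0|].
Qed.

Lemma mnorm_ge0 n (x : 'I_n -> X) : 0 <= mnorm x.
Proof. by apply: le_trans (mnorm_ub x (@contr0 n)); exact: sqrtr_ge0. Qed.

Lemma sumsq_single n (x : 'I_n -> X) i e : nrm (sumsq (fun k => if k == i then e else 0) x) =
  nrm (ip e (x i)) ^+ 2.
Proof.
rewrite -(ca_cstar HA) /sumsq (bigD1 i) //= eqxx big1 ?addr0 // => k /negPf ->.
by rewrite ip0l (cmulr0 HA).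
Qed.

(** The test family has the normalized [x i] in slot [i] and zero elsewhere; it is contractive by
    Cauchy-Schwarz. Definiteness of the multi-norm follows. *)
Lemma hn_le_mnorm n (x : 'I_n -> X) i : hn (x i) <= mnorm x.
Proof.
have [->|z0] := eqVneq (hn (x i)) 0; first exact: mnorm_ge0.
have zp : 0 < hn (x i) by rewrite lt0r z0 hn_ge0.
have c : cmod ((hn (x i))^-1%:C) = (hn (x i))^-1.
  by rewrite cmod_real gtr0_norm ?invr_gt0.
pose e := (hn (x i))^-1%:C *: x i.
have e1 : hn e = 1 by rewrite hnZ c mulVf.
have ec : contr (fun k => if k == i then e else 0).
  move=> z z1; rewrite (sumsq_single (fun=> z)) -(expr1n R 2) ler_pXn2r ?nnegrE //.
  by rewrite (le_trans (ip_le _ _)) // e1 mul1r.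
apply: le_trans (mnorm_ub x ec); rewrite -sqrt_sumsq sumsq_single.
rewrite sqrtr_sqr ger0_norm // /e (ipZl HA ipZr ip_star) conjc_real (ca_nrmZ HA) c.
by rewrite (hnormE HA) expr2 mulrA mulVf // mul1r.
Qed.

Lemma mnormZ_le n (x : 'I_n -> X) (k : R[i]) : mnorm (fun i => k *: x i) <= cmod k * mnorm x.
Proof.
apply: mnorm_le => y yc.
rewrite [X in fhn X](_ : _ = k *: [ffun i => ip (y i) (x i)]); last first.
  by apply/ffunP => i; rewrite !ffunE ipZr.
rewrite (hnormZ HA (fipZr HA (I := _)) (fip_star HA (I := _))) ler_wpM2l ?cmod_ge0 //.
exact: mnorm_ub.
Qed.

Lemma mnormZ n (x : 'I_n -> X) (k : R[i]) : mnorm (fun i => k *: x i) = cmod k * mnorm x.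
Proof.
apply/eqP; rewrite eq_le mnormZ_le /=.
have [->|k0] := eqVneq k 0; first by rewrite cmod0 mul0r mnorm_ge0.
have := mnormZ_le (fun i => k *: x i) k^-1.
have -> : (fun i => k^-1 *: (k *: x i)) = x.
  by apply/funext => i; rewrite scalerA mulVf // scale1r.
move=> /(ler_wpM2l (cmod_ge0 k)).
by rewrite mulrA -cmodM mulfV // cmod1 mul1r.
Qed.

Lemma mnormD n (x y : 'I_n -> X) : mnorm (fun i => x i + y i) <= mnorm x + mnorm y.
Proof.
apply: mnorm_le => w wc.
rewrite [X in fhn X](_ : _ = [ffun i => ip (w i) (x i)] + [ffun i => ip (w i) (y i)]).
  apply: (le_trans (hnorm_triangle (fipDr HA (I := _)) (fipZr HA (I := _)) (fipM HA (I := _)) (fip_star HA (I := _)) (fip_psd HA (I := _)) _ _)).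
  by apply: lerD; exact: mnorm_ub.
by apply/ffunP => i; rewrite !ffunE ipDr.
Qed.

Lemma mnorm_is_norm n : is_norm_n (fun x : 'I_n -> X => mnorm x).
Proof.
split.
- exact: mnorm_ge0.
- move=> x x0 i; apply: hn_eq0; apply/eqP; rewrite eq_le hn_ge0 andbT -x0.
  exact: hn_le_mnorm.
- by move=> k x; exact: mnormZ.
- exact: mnormD.
Qed.

Lemma mnorm_one (x0 : X) : mnorm (fun _ : 'I_1 => x0) = hn x0.
Proof.
apply/eqP; rewrite eq_le (hn_le_mnorm (fun=> x0) ord0) andbT.
apply: mnorm_le => y yc; rewrite -sqrt_sumsq /sumsq big_ord1 (ca_cstar HA).
by rewrite sqrtr_sqr ger0_norm //; exact: contr_ip_le.
Qed.

(** * Permutations and scalar multipliers: (A1) and (A2) *)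

Lemma sumsq_perm n (y x : 'I_n -> X) (s : 'S_n) :
  sumsq (fun i => y (s i)) (fun i => x (s i)) = sumsq y x.
Proof. by rewrite /sumsq [RHS](reindex_inj (@perm_inj _ s)). Qed.

Lemma contr_perm n (y : 'I_n -> X) (s : 'S_n) : contr y -> contr (fun i => y (s i)).
Proof. by move=> yc z /yc; rewrite -(sumsq_perm y (fun=> z) s). Qed.

Lemma mnorm_perm_le n (x : 'I_n -> X) (s : 'S_n) : mnorm (fun i => x (s i)) <= mnorm x.
Proof.
apply: mnorm_le => y yc; have yc' := contr_perm s^-1 yc.
apply: le_trans (mnorm_ub x yc'); rewrite -!sqrt_sumsq -(sumsq_perm _ x s).
by rewrite (_ : (fun i => y (s^-1%g (s i))) = y) //; apply/funext => i; rewrite permK.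
Qed.

Lemma mnorm_perm n (x : 'I_n -> X) (s : 'S_n) : mnorm (fun i => x (s i)) = mnorm x.
Proof.
apply/eqP; rewrite eq_le mnorm_perm_le /=.
have := mnorm_perm_le (fun i => x (s i)) s^-1.
by rewrite (_ : (fun i => x (s (s^-1%g i))) = x) //; apply/funext => i; rewrite permKV.
Qed.

Lemma mnorm_mul_le n (x : 'I_n -> X) (al : 'I_n -> R[i]) :
  mnorm (fun i => al i *: x i) <= (\big[Num.max/0]_(i < n) cmod (al i)) * mnorm x.
Proof.
set M := \big[_/_]_(_ < _) _.
have alM i : cmod (al i) <= M by rewrite /M (bigD1 i) //= le_max lexx.
have M0 : 0 <= M.
  by rewrite /M; elim/big_ind: _ => [|a b a0 b0|i _]; rewrite ?le_max ?a0 ?cmod_ge0.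
apply: mnorm_le => y yc; rewrite -sqrt_sumsq.
have -> : M * mnorm x = Num.sqrt (M ^+ 2 * mnorm x ^+ 2).
  by rewrite -exprMn sqrtr_sqr ger0_norm // mulr_ge0 // mnorm_ge0.
apply: ler_wsqrtr; apply: (@le_trans _ _ (M ^+ 2 * nrm (sumsq y x))); last first.
  apply: ler_wpM2l; first exact: sqr_ge0.
  rewrite -(sqr_sqrtr (nrm_ge0 (sumsq y x))) ler_pXn2r ?nnegrE ?sqrtr_ge0 ?mnorm_ge0 //.
  by rewrite sqrt_sumsq; exact: mnorm_ub.
have -> : M ^+ 2 * nrm (sumsq y x) = nrm ((M ^+ 2)%:C *: sumsq y x).
  by rewrite (ca_nrmZ HA) cmod_real ger0_norm // sqr_ge0.
apply: (psd_mono (HA := HA)); first exact: psd_sumsq.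
(* The comparison is made in [A], term by term: each difference is [M^2 - |al i|^2 >= 0] times a
   positive element. *)
rewrite scaler_sumr -sumrB; apply: psd_sum => i _.
rewrite ipZr (ca_starZ HA) (ca_mulZl HA) (ca_mulZr HA) scalerA cmod_conjM.
rewrite -scalerBl -rmorphB /=; apply: psdZ; last exact: psd_sqr.
by rewrite subr_ge0 ler_pXn2r ?nnegrE ?cmod_ge0.
Qed.

(** * Families with one more entry: (A3) and (A4) *)

Lemma sumsq_recr n (y x : 'I_n.+1 -> X) :
  sumsq y x = sumsq (fun i => y (lift ord_max i)) (fun i => x (lift ord_max i)) +
    mul (star (ip (y ord_max) (x ord_max))) (ip (y ord_max) (x ord_max)).
Proof.
have lw i : widen_ord (leqnSn n) i = lift ord_max i.
  by apply: val_inj; rewrite [RHS]lift_max.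
by rewrite /sumsq big_ord_recr /=; congr (_ + _); apply: eq_bigr => i _; rewrite !lw.
Qed.

(** Written so that [extend x 0] and [extend x (x ord_max)] are the families of [mn_A3] and [mn_A4]
    up to conversion. *)
Definition extend n (x : 'I_n -> X) (a : X) (i : 'I_n.+1) : X :=
  if unlift ord_max i is Some k then x k else a.

Lemma extend_lift n (x : 'I_n -> X) a i : extend x a (lift ord_max i) = x i.
Proof. by rewrite /extend liftK. Qed.

Lemma extend_max n (x : 'I_n -> X) a : extend x a ord_max = a.
Proof. by rewrite /extend unlift_none. Qed.

Lemma sumsq_extend n (y : 'I_n.+1 -> X) (x : 'I_n -> X) a :
  sumsq y (extend x a) = sumsq (fun i => y (lift ord_max i)) x +
    mul (star (ip (y ord_max) a)) (ip (y ord_max) a).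
Proof.
rewrite sumsq_recr extend_max; congr (_ + _).
by apply: eq_bigr => i _; rewrite extend_lift.
Qed.

Lemma sumsq_extendl n (y : 'I_n -> X) b (x : 'I_n.+1 -> X) :
  sumsq (extend y b) x = sumsq y (fun i => x (lift ord_max i)) +
    mul (star (ip b (x ord_max))) (ip b (x ord_max)).
Proof.
rewrite sumsq_recr extend_max; congr (_ + _).
by apply: eq_bigr => i _; rewrite extend_lift.
Qed.

(** Contractive families of the two lengths correspond: dropping the last entry only decreases the
    sums, and appending zero leaves them unchanged. *)
Lemma mnorm_extend0 n (x : 'I_n -> X) : mnorm (extend x 0) = mnorm x.
Proof.
apply/eqP; rewrite eq_le; apply/andP; split; apply: mnorm_le => y yc.
  have yc' : contr (fun i => y (lift ord_max i)).
    move=> z z1; apply: le_trans (yc z z1); rewrite [X in _ <= nrm X]sumsq_recr.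
    apply: (psd_mono (HA := HA)); first exact: psd_sumsq.
    by rewrite addrAC subrr add0r; exact: psd_sqr.
  apply: le_trans (mnorm_ub x yc'); rewrite -!sqrt_sumsq sumsq_extend.
  by rewrite ip0r (cmulr0 HA) addr0.
have yc' : contr (extend y 0).
  by move=> z z1; rewrite sumsq_extendl ip0l (cmulr0 HA) addr0; exact: yc.
apply: le_trans (mnorm_ub _ yc'); rewrite -!sqrt_sumsq sumsq_extend.
rewrite extend_max ip0l (cmulr0 HA) addr0.
by under [in leRHS]eq_fun do rewrite extend_lift.
Qed.

(** Cauchy-Schwarz in [A^2] for the columns [(a, b)] and [(p, q)], the former lying in the unit
    ball. *)
Lemma column_contraction a b p q : nrm (mul (star a) a + mul (star b) b) <= 1 ->
  let g := mul (star a) p + mul (star b) q in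
  psd HA (mul (star p) p + mul (star q) q - mul (star g) g).
Proof.
pose F (c d : A) : {ffun bool -> A} := [ffun i => if i then c else d].
have FE c d c' d' : fip mul star (F c d) (F c' d') = mul (star c) c' + mul (star d) d'.
  by rewrite /fip big_bool !ffunE.
move=> ab1 g.
have := @ip_cauchy_schwarz_psd _ _ _ _ _ HA _ _ _
  (fipDr HA (I := _)) (fipZr HA (I := _)) (fipM HA (I := _)) (fip_star HA (I := _)) (fip_psd HA (I := _)) (F a b) (F p q).
by rewrite !FE => /(_ ab1).
Qed.

Lemma mnorm_repeat_le m (x : 'I_m.+1 -> X) : mnorm (extend x (x ord_max)) <= mnorm x.
Proof.
apply: mnorm_le => y yc; rewrite -sqrt_sumsq.
have N0 := mnorm_ge0 x.
rewrite -(ler_pXn2r (n := 2)) ?nnegrE ?sqrtr_ge0 // sqr_sqrtr //.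
apply/ler_addgt0Pr => e e0.
(* The last two entries of [y] are both paired with [x1], so they can be merged into one. *)
pose y1 := y (lift ord_max ord_max); pose y2 := y ord_max; pose x1 := x ord_max.
have [a [b [ab1]]] := approx_polar HA (ip y1 x1) (ip y2 x1) e0.
set w := mul (star a) (ip y1 x1) + _; move=> we.
pose y' := extend (fun i : 'I_m => y (lift ord_max (lift ord_max i))) (act y1 a + act y2 b).
have ipy' z : ip (act y1 a + act y2 b) z = mul (star a) (ip y1 z) + mul (star b) (ip y2 z).
  by rewrite (ipDl HA ipDr ip_star) !(ipMl HA (hm_ipM HX) ip_star).
have yc' : contr y'.
  move=> z z1; apply: le_trans (yc z z1).
  (* For every [z], merging replaces the last two squares by a single one that their sum
     dominates. *)
  rewrite sumsq_extendl ipy' [X in _ <= nrm X]sumsq_recr [X in _ <= nrm (X + _)]sumsq_recr.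
  apply: (psd_mono (HA := HA)).
    by apply: psdD; [exact: psd_sumsq|exact: psd_sqr].
  rewrite -(addrA (sumsq _ _)) opprD addrACA subrr add0r.
  exact: column_contraction.
have := mnorm_ub x yc'; rewrite -sqrt_sumsq => sN.
have {sN} : nrm (sumsq y' x) <= mnorm x ^+ 2.
  by rewrite -(sqr_sqrtr (nrm_ge0 (sumsq y' x))) ler_pXn2r ?nnegrE ?sqrtr_ge0.
move=> /(lerD we).
rewrite [in leRHS]addrC; apply: le_trans.
(* The sum for [y] is the sum for [y'] plus the polar defect at [x1], whose norm is at most [e]. *)
apply: le_trans (ca_nrmD HA _ _).
rewrite sumsq_extend [sumsq y' x]sumsq_extendl ipy' sumsq_recr -/x1 -/w.
by rewrite addrCA subrK addrA.
Qed.

End HilbertModule.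

Theorem mainTheorem1 (R : realType)
    (A : lmodType R[i]) (mul : A -> A -> A) (star : A -> A) (nrm : A -> R)
    (X : lmodType R[i]) (act : X -> A -> X) (ip : X -> X -> A) :
  is_cstar_algebra mul star nrm ->
  is_hilbert_module mul star nrm act ip ->
  is_multinorm (hnorm nrm ip) (fun n => @mnorm_star R A mul star nrm X ip n).
Proof.
move=> HA HX; split.
- by move=> n _; exact: (mnorm_is_norm HA HX).
- exact: (mnorm_one HA HX).
- by move=> n x s _; exact: (mnorm_perm HA HX).
- by move=> n x al _; exact: (mnorm_mul_le HA HX).
- by move=> m x; exact: (mnorm_extend0 HA HX).
- by move=> m x; exact: (mnorm_repeat_le HA HX).
Qed.
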